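(* Let $\mathbf{k}$ be a field of characteristic $0$, $m$ a positive integer, and for $i=1,\dots,m$ let $X_i \subseteq V_i$ be a conical subscheme of a finite-dimensional vector space $V_i$. For every positive integer $r$ there is an integer $C_{\mathbf{X}}(r)$, depending on $r$ and the $X_i$ but independent of $\mathbf{d}$, such that for every $m$-tuple of positive integers $\mathbf{d}=(d_1,\dots,d_m)$ the ideal of $\mathrm{Sec}_{\mathbf{d},r}(\mathbf{X})$ is generated by polynomials of degree $\le C_{\mathbf{X}}(r)$.
   Context: A subscheme $X_i\subseteq V_i$ is conical if its ideal $I_{X_i}\subseteq \mathrm{Sym}(V_i^* )$ is homogeneous; set $B^{(i)} = \mathrm{Sym}(V_i^* )/I_{X_i}$ and let $R = B^{(1)}\otimes\cdots\otimes B^{(m)}$ with its $\mathbf{Z}_{\ge0}^m$-grading, $R_{\mathbf{d}} = B^{(1)}_{d_1}\otimes\cdots\otimes B^{(m)}_{d_m}$. For a vector space $W$ and ideals $I,J\subseteq\mathrm{Sym}(W)$, the join $I\star J$ is the kernel of $\mathrm{Sym}(W)\xrightarrow{\Delta}\mathrm{Sym}(W)\otimes\mathrm{Sym}(W)\to \mathrm{Sym}(W)/I\otimes\mathrm{Sym}(W)/J$, where $\Delta$ is the algebra homomorphism with $\Delta(w)=w\otimes1+1\otimes w$ for $w\in W$; $I^{\star1}=I$, $I^{\star r}=I\star I^{\star(r-1)}$. Let $J_{\mathbf{d}}\subseteq\mathrm{Sym}(R_{\mathbf{d}})$ be the kernel of the multiplication map $\mathrm{Sym}(R_{\mathbf{d}})\to\bigoplus_{e\ge0}R_{e\mathbf{d}}$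 (the ideal of the Segre--Veronese embedding of $X_1\times\cdots\times X_m$ given by $\mathbf{d}$). $\mathrm{Sec}_{\mathbf{d},r}(\mathbf{X})$ is the subscheme of $R_{\mathbf{d}}^*\subseteq \mathrm{D}^{d_1}V_1\otimes\cdots\otimes\mathrm{D}^{d_m}V_m$ defined by $J_{\mathbf{d}}^{\star r}$; for varieties over an algebraically closed field it is the Zariski closure of the set of sums $\sum_{i=1}^r x_{1,i}^{\otimes d_1}\otimes\cdots\otimes x_{m,i}^{\otimes d_m}$ with $x_{j,i}\in X_j$. *)

(* Defs.v *)
From HB Require Import structures.
From mathcomp Require Import all_boot all_order all_algebra.
From mathcomp Require Export mpoly.
Set Implicit Arguments. Unset Strict Implicit. Unset Printing Implicit Defensive.
Import GRing.Theory.
Local Open Scope ring_scope.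

Section Defs.
Variable k : fieldType.

Definition polyset (n : nat) := {mpoly k[n]} -> Prop.

Definition in_ideal_gen (n : nat) (S : polyset n) (p : {mpoly k[n]}) : Prop :=
  exists s : seq ({mpoly k[n]} * {mpoly k[n]}),
    (forall x, x \in s -> S x.2) /\ p = \sum_(x <- s) x.1 * x.2.

Definition generated_in_degree_le (n : nat) (J : polyset n) (C : nat) : Prop :=
  forall p, J p <-> in_ideal_gen (fun q => J q /\ (msize q <= C.+1)%N) p.

(* Join of ideals of Sym(W) = k[D] (W with a fixed basis of size D):
   Sym(W)/I (x) Sym(W)/J is realised as k[y,z]/(I(y) + J(z)) in 2D variables,
   and Delta(x_j) = y_j + z_j. *)
Definition subst (D N : nat) (v : 'I_D -> {mpoly k[N]}) (p : {mpoly k[D]})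
  : {mpoly k[N]} := mmap (@mpolyC N k) v p.

Definition yvar (D : nat) (j : 'I_D) : {mpoly k[D + D]} := 'X_(lshift D j).
Definition zvar (D : nat) (j : 'I_D) : {mpoly k[D + D]} := 'X_(rshift D j).

Definition join (D : nat) (I J : polyset D) : polyset D := fun p =>
  in_ideal_gen
    (fun q => (exists a, I a /\ q = subst (@yvar D) a) \/
              (exists b, J b /\ q = subst (@zvar D) b))
    (subst (fun j => yvar j + zvar j) p).

(* join_pow I r = I^{*r} for r >= 1 (I^{*1} = I, I^{*r} = I * I^{*(r-1)});
   the value at r = 0 is a dummy (I). *)
Fixpoint join_pow (D : nat) (I : polyset D) (r : nat) : polyset D :=
  match r with
  | 0 => I
  | r'.+1 => match r' with 0 => I | _ => join I (join_pow I r') end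
  end.

(* Ambient ring k[V] = k[V_1 (+) ... (+) V_m], with coordinates x_0..x_{n-1};
   the coordinate x_j is a coordinate on V_(blk j). *)
Variables (n m : nat) (blk : 'I_n -> 'I_m).

Definition in_block (i : 'I_m) (p : {mpoly k[n]}) : Prop :=
  forall mo, mo \in msupp p -> forall j, blk j != i -> mo j = 0%N.

Definition hcomp (t : nat) (p : {mpoly k[n]}) : {mpoly k[n]} :=
  \sum_(mo <- msupp p | mdeg mo == t) p@_mo *: 'X_[mo].

(* I is a homogeneous ideal of Sym(V_i^* ), i.e. the ideal of a conical
   subscheme X_i of V_i. *)
Definition homog_ideal_of_block (i : 'I_m) (I : polyset n) : Prop :=
  [/\ forall p, I p -> in_block i p,
      I 0,
      forall p q, I p -> I q -> I (p + q),
      forall a p, in_block i a -> I p -> I (a * p)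
    & forall p t, I p -> I (hcomp t p)].

(* The ideal of k[V] generated by I_{X_1}, ..., I_{X_m}; k[V]/Iext is
   R = B^(1) (x) ... (x) B^(m). *)
Definition Iext (I : 'I_m -> polyset n) : polyset n :=
  in_ideal_gen (fun q => exists i, I i q).

Definition bdeg (mo : 'X_{1..n}) (i : 'I_m) : nat :=
  (\sum_(j < n | blk j == i) mo j)%N.

Definition multihomog (d : 'I_m -> nat) (p : {mpoly k[n]}) : Prop :=
  forall mo, mo \in msupp p -> forall i, bdeg mo i = d i.

(* b_0, ..., b_{D-1} (multihomogeneous of multidegree d) reduce to a basis of
   R_d = B^(1)_{d_1} (x) ... (x) B^(m)_{d_m} = k[V]_d / (Iext)_d. *)
Definition is_basis_Rd (I : 'I_m -> polyset n) (d : 'I_m -> nat)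
    (D : nat) (b : 'I_D -> {mpoly k[n]}) : Prop :=
  [/\ forall j, multihomog d (b j),
      forall c : 'I_D -> k, Iext I (\sum_j c j *: b j) -> forall j, c j = 0
    & forall q, multihomog d q ->
        exists c : 'I_D -> k, Iext I (q - \sum_j c j *: b j)].

(* J_d : kernel of Sym(R_d) = k[D] -> (+)_e R_{e d} subset R, x_j |-> b_j. *)
Definition Jd (I : 'I_m -> polyset n) (D : nat) (b : 'I_D -> {mpoly k[n]})
  : polyset D := fun p => Iext I (subst b p).

Definition sec_ideal (I : 'I_m -> polyset n) (D : nat)
    (b : 'I_D -> {mpoly k[n]}) (r : nat) : polyset D :=
  join_pow (Jd I b) r.

End Defs.

(* Main.v *)
Require Import Defs.
From HB Require Import structures.
From mathcomp Require Import all_boot all_order all_algebra.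
From mathcomp Require Import ssrcomplements mpoly.
From Stdlib Require Import Classical IndefiniteDescription.
Set Implicit Arguments. Unset Strict Implicit. Unset Printing Implicit Defensive.
Import Order.TTheory GRing.Theory.
Local Open Scope ring_scope.

(** In characteristic 0, the degree e part of the secant ideal is the space of
    symmetric tensors in [R_d^{(x) e}] which vanish on every e-tuple of points of
    X having at most r distinct entries.  Drop the symmetry, keep e, and let d
    vary: these tensors are stable under multiplication by words of length e in
    the monomials (which increases d) and under insertion of one more tensor
    factor of degree d (which increases e).  Their leading words, for a
    lexicographic order, are thus closed upwards for the Higman embedding order
    built on divisibility of monomials.  By Higman's lemma that order is a well
    quasi-order, so there is a C, independent of d, such that beyond length C
    every leading word comes by insertion from a shorter one.  The division
    algorithm then writes every tensor of length e > C as a combination of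
    insertions into tensors of length e - 1; multiplying out tensor factors in
    [Sym(R_d)], this says that degree e - 1 generates degree e. *)

(** * Dickson's and Higman's lemmas *)

Definition increasing (g : nat -> nat) := forall i j, (i < j)%N -> (g i < g j)%N.

Lemma increasing_step (g : nat -> nat) :
  (forall i, (g i < g i.+1)%N) -> increasing g.
Proof.
move=> gS i j; elim: j => // j IH; rewrite ltnS leq_eqVlt => /orP[/eqP->|/IH h] //.
exact: ltn_trans h (gS j).
Qed.

(** Well quasi-orders, in the form with infinite ascending subsequences: it passes to products by
    repeated extraction, and it is what the minimal bad sequence argument asks of the letters. *)
Definition subwqo (T : Type) (R : T -> T -> Prop) := forall f : nat -> T,
  exists g, increasing g /\ forall i j, (i < j)%N -> R (f (g i)) (f (g j)).

Lemma tail_argmin (f : nat -> nat) (a : nat) :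
  exists i, (a <= i)%N /\ forall j, (a <= j)%N -> (f i <= f j)%N.
Proof.
have: exists i, (a <= i)%N by exists a.
case=> i; have [N] := ubnP (f i); elim: N i => // N IH i fiN ai.
have [h|h] := classic (exists j, (a <= j)%N /\ (f j < f i)%N).
  by case: h => j [aj fj]; apply: (IH j) => //; apply: leq_trans fj _.
exists i; split=> // j aj; rewrite leqNgt; apply/negP => fj.
by apply: h; exists j.
Qed.

Lemma subwqo_nat : subwqo (fun a b : nat => (a <= b)%N).
Proof.
move=> f; have [h hP] := functional_choice _ (tail_argmin f).
(* [h a] is a position where [f] is least on the tail from [a]. Each next index is the argmin
   strictly past the previous one, so the values along [g] cannot drop. *)
pose fix g i := if i is i'.+1 then h (g i').+1 else h 0%N.
have gS i : (g i < g i.+1)%N by have [] := hP (g i).+1.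
exists g; split; first exact: increasing_step.
have ginc := increasing_step gS.
case=> [|i] j ij; first by have [_] := hP 0%N; apply.
have [_] := hP (g i).+1; apply; apply: ltn_trans (gS i) _; exact: ginc.
Qed.

(** Dickson's lemma: a subsequence is extracted for one exponent after the other, and further
    extraction preserves the monotonicity already obtained. *)
Lemma subwqo_mnm n : subwqo (fun a b : 'X_{1..n} => (a <= b)%MM).
Proof.
move=> f.
suff [g [ginc gP]] : exists g, increasing g /\
    forall c : 'I_n, c \in enum 'I_n -> forall i j, (i < j)%N ->
      (f (g i) c <= f (g j) c)%N.
  exists g; split=> // i j ij; apply/mnm_lepP => c; apply: gP => //.
  by rewrite mem_enum.
elim: (enum 'I_n) => [|c s [g [ginc gP]]]; first by exists id; split.
have [h [hinc hP]] := subwqo_nat (fun i => f (g i) c).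
exists (g \o h); split=> [i j ij|c']; first by apply/ginc/hinc.
rewrite inE => /orP[/eqP->|c's] i j ij; first exact: hP.
by apply: gP => //; apply: hinc.
Qed.

Section Higman.
Variables (T : Type) (R : T -> T -> Prop).

Inductive hemb : seq T -> seq T -> Prop :=
| hemb_nil w : hemb [::] w
| hemb_skip u w a : hemb u w -> hemb u (a :: w)
| hemb_cons u w a b : R a b -> hemb u w -> hemb (a :: u) (b :: w).

Definition bad (f : nat -> seq T) := forall i j, (i < j)%N -> ~ hemb (f i) (f j).

(** One stage of the minimal bad sequence: the words before [i] are frozen and the [i]-th is made as
    short as badness allows. *)
Lemma bad_minimize (i : nat) (f : nat -> seq T) : bad f -> exists g,
  [/\ bad g, forall j, (j < i)%N -> g j = f j
    & forall h, bad h -> (forall j, (j < i)%N -> h j = f j) ->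
      (size (g i) <= size (h i))%N].
Proof.
move=> fbad.
suff H N : forall g, bad g -> (forall j, (j < i)%N -> g j = f j) ->
    (size (g i) < N)%N -> exists g',
  [/\ bad g', forall j, (j < i)%N -> g' j = f j
    & forall h, bad h -> (forall j, (j < i)%N -> h j = f j) ->
      (size (g' i) <= size (h i))%N].
  exact: (H _ f fbad).
elim: N => // N IH g gbad gf gN.
have [[h [hbad [hf hg]]]|nh] := classic (exists h, bad h /\
   (forall j, (j < i)%N -> h j = f j) /\ (size (h i) < size (g i))%N).
  by apply: (IH h) => //; apply: leq_trans hg _.
exists g; split=> // h hbad hf; rewrite leqNgt; apply/negP => hg.
by apply: nh; exists h.
Qed.

(* Nash-Williams' minimal bad sequence. *)
Lemma higman : subwqo R -> forall f : nat -> seq T,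
  exists i j, (i < j)%N /\ hemb (f i) (f j).
Proof.
move=> wqoR f; apply: NNPP => nf.
have fbad : bad f by move=> i j ij ff; apply: nf; exists i, j.
have [next nextP] : exists next : nat * (nat -> seq T) -> (nat -> seq T),
    forall x, bad x.2 ->
  [/\ bad (next x), forall j, (j < x.1)%N -> next x j = x.2 j
    & forall h, bad h -> (forall j, (j < x.1)%N -> h j = x.2 j) ->
      (size (next x x.1) <= size (h x.1))%N].
  apply: (functional_choice (fun (x : nat * (nat -> seq T)) g => bad x.2 ->
  [/\ bad g, forall j, (j < x.1)%N -> g j = x.2 j
    & forall h, bad h -> (forall j, (j < x.1)%N -> h j = x.2 j) ->
      (size (g x.1) <= size (h x.1))%N])) => -[i g] /=.
  have [gbad|ngbad] := classic (bad g); last by exists g.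
  by have [g' g'P] := bad_minimize i gbad; exists g'.
pose fix F i := if i is i'.+1 then next (i', F i') else f.
have Fbad i : bad (F i) by elim: i => //= i IH; have [] := nextP (i, F i) IH.
have Fagree i j : (i < j)%N -> F j i = F i.+1 i.
  elim: j => // j IH; rewrite ltnS leq_eqVlt => /orP[/eqP->//|ij].
  by rewrite -IH //; have [_ + _] := nextP (j, F j) (Fbad j); apply.
(* Stage [i.+1] settles the word at [i] for good, so every initial segment of the diagonal [M] is an
   initial segment of some bad [F j]. *)
pose M i := F i.+1 i.
have Mbad : bad M.
  move=> i j ij; rewrite /M -(Fagree i j.+1) //; last exact: ltn_trans ij _.
  exact: Fbad.
have Mmin i h : bad h -> (forall j, (j < i)%N -> h j = M j) ->
    (size (M i) <= size (h i))%N.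
  move=> hbad hM; have [_ _ +] := nextP (i, F i) (Fbad i); apply=> // j ji.
  by rewrite hM //= Fagree.
have [ht htP] : exists ht : nat -> T * seq T, forall i, M i = (ht i).1 :: (ht i).2.
  apply: (functional_choice (fun i x => M i = x.1 :: x.2)) => i.
  case E: (M i) => [|a w]; last by exists (a, w).
  by case: (Mbad i i.+1 (ltnSn i)); rewrite E; apply: hemb_nil.
have [g [ginc gP]] := wqoR (fun i => (ht i).1).
(* The heads ascend along [g]. Following [M] up to [g 0] and then the tails along [g] gives a
   sequence that is again bad but has a shorter word at [g 0], against minimality. *)
pose h i := if (i < g 0)%N then M i else (ht (g (i - g 0)%N)).2.
have gge i : (g 0 <= g i)%N by case: i => // i; apply/ltnW/ginc.
suff hbad : bad h.
  have : (size (M (g 0%N)) <= size (h (g 0%N)))%N by apply: Mmin => // j; rewrite /h => ->.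
  by rewrite /h ltnn subnn htP /= ltnn.
move=> i j ij; rewrite /h; case: (ltnP j (g 0)) => jg.
  by rewrite (ltn_trans ij jg); apply: Mbad.
case: (ltnP i (g 0)) => ig.
  move=> e; apply: (Mbad i (g (j - g 0)%N)); first exact: leq_trans ig (gge _).
  by rewrite (htP (g _)); apply: hemb_skip.
move=> e; have ij' : (i - g 0 < j - g 0)%N by rewrite ltn_sub2r // (leq_ltn_trans ig ij).
apply: (Mbad _ _ (ginc _ _ ij')); rewrite !htP; apply: hemb_cons => //.
exact: gP.
Qed.

Lemma hemb_size u w : hemb u w -> (size u <= size w)%N.
Proof. by elim=> //= *; exact: leqW. Qed.

End Higman.

(** * Ideals and substitutions *)

Section Ideals.
Variables (k : fieldType) (n : nat).
Implicit Types (S : polyset k n) (p q : {mpoly k[n]}).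

Lemma ideal0 S : in_ideal_gen S 0.
Proof. by exists [::]; split=> //; rewrite big_nil. Qed.

Lemma idealD S p q : in_ideal_gen S p -> in_ideal_gen S q -> in_ideal_gen S (p + q).
Proof.
move=> [s [sS ->]] [t [tS ->]]; exists (s ++ t); split; last by rewrite big_cat.
by move=> x; rewrite mem_cat => /orP[/sS|/tS].
Qed.

Lemma idealM S a p : in_ideal_gen S p -> in_ideal_gen S (a * p).
Proof.
move=> [s [sS ->]]; exists [seq (a * x.1, x.2) | x <- s]; split.
  by move=> _ /mapP[x xs ->]; exact: (sS _ xs).
by rewrite big_map mulr_sumr; apply: eq_bigr => x _; rewrite mulrA.
Qed.

Lemma ideal_gen S p : S p -> in_ideal_gen S p.
Proof.
move=> Sp; exists [:: (1, p)]; split; last by rewrite big_seq1 mul1r.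
by move=> x; rewrite inE => /eqP->.
Qed.

Lemma idealZ S c p : in_ideal_gen S p -> in_ideal_gen S (c *: p).
Proof. by rewrite -mul_mpolyC; exact: idealM. Qed.

Lemma idealB S p q : in_ideal_gen S p -> in_ideal_gen S q -> in_ideal_gen S (p - q).
Proof. by move=> hp hq; apply: idealD => //; rewrite -scaleN1r; exact: idealZ. Qed.

Lemma ideal_sum S (J : eqType) (s : seq J) (P : pred J) (F : J -> {mpoly k[n]}) :
  (forall j, j \in s -> P j -> in_ideal_gen S (F j)) ->
  in_ideal_gen S (\sum_(j <- s | P j) F j).
Proof.
move=> h; rewrite big_seq_cond; apply: (big_ind (in_ideal_gen S)).
- exact: ideal0.
- exact: idealD.
- by move=> j /andP[]; exact: h.
Qed.

Lemma ideal_min S (J : polyset k n) : J 0 -> (forall p q, J p -> J q -> J (p + q)) ->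
  (forall a p, S p -> J (a * p)) -> forall p, in_ideal_gen S p -> J p.
Proof.
move=> J0 JD JM p [s [sS ->]]; rewrite big_seq; apply: (big_ind J) => //.
by move=> x /sS; exact: JM.
Qed.

Lemma ideal_sub S (S' : polyset k n) : (forall p, S p -> in_ideal_gen S' p) ->
  forall p, in_ideal_gen S p -> in_ideal_gen S' p.
Proof.
move=> h; apply: ideal_min; [exact: ideal0|exact: idealD|].
by move=> a p /h; exact: idealM.
Qed.

Lemma ideal_congr S p q : in_ideal_gen S (p - q) -> in_ideal_gen S q -> in_ideal_gen S p.
Proof. by move=> h hq; rewrite -[p](subrK q); exact: idealD. Qed.

End Ideals.

Section Subst.
Variables (k : fieldType).

Section One.
Variables (n N : nat) (v : 'I_n -> {mpoly k[N]}).

HB.instance Definition _ :=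
  GRing.RMorphism.copy (subst v) (mmap (@mpolyC N k) v).

Lemma substX i : subst v 'X_i = v i.
Proof. by rewrite /subst mmapX mmap1U. Qed.

Lemma substXm (mo : 'X_{1..n}) : subst v 'X_[mo] = \prod_i v i ^+ mo i.
Proof. by rewrite /subst mmapX. Qed.

Lemma substC c : subst v c%:MP = c%:MP.
Proof. by rewrite /subst mmapC. Qed.

Lemma substZ c p : subst v (c *: p) = c *: subst v p.
Proof. by rewrite -mul_mpolyC rmorphM /= substC mul_mpolyC. Qed.

Lemma subst_eq (v' : 'I_n -> {mpoly k[N]}) p : v =1 v' -> subst v p = subst v' p.
Proof.
by move=> h; rewrite /subst /mmap; apply: eq_bigr => mo _; rewrite (mmap1_eq _ h).
Qed.

Lemma substE p : subst v p = \sum_(mo <- msupp p) p@_mo *: \prod_i v i ^+ mo i.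
Proof. by rewrite /subst /mmap; apply: eq_bigr => mo _; rewrite mul_mpolyC. Qed.

End One.

Lemma subst_comp (n N M : nat) (v : 'I_n -> {mpoly k[N]}) (u : 'I_N -> {mpoly k[M]}) p :
  subst u (subst v p) = subst (fun i => subst u (v i)) p.
Proof.
rewrite (substE v p) rmorph_sum substE; apply: eq_bigr => mo _.
by rewrite /= substZ rmorph_prod; congr (_ *: _); apply: eq_bigr => i _; rewrite rmorphXn.
Qed.

Lemma subst_id n (p : {mpoly k[n]}) : subst (fun i => 'X_i) p = p.
Proof.
by rewrite substE [RHS]mpolyE; apply: eq_bigr => mo _; rewrite -mpolyXE_id.
Qed.

Lemma subst_ideal (n N : nat) (v : 'I_n -> {mpoly k[N]}) (S : polyset k n)
    (S' : polyset k N) : (forall p, S p -> in_ideal_gen S' (subst v p)) ->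
  forall p, in_ideal_gen S p -> in_ideal_gen S' (subst v p).
Proof.
move=> h; apply: ideal_min => [|p q hp hq|a p /h hp].
- by rewrite rmorph0; exact: ideal0.
- by rewrite rmorphD; exact: idealD.
- by rewrite rmorphM; exact: idealM.
Qed.

End Subst.

(** * Linear extension from monomials *)

Section LinearExtension.
Variables (k : fieldType) (n : nat) (V : lmodType k) (g : 'X_{1..n} -> V).

Definition mlin (p : {mpoly k[n]}) : V := \sum_(mo <- msupp p) p@_mo *: g mo.

(** A common finite index set for polynomials with different supports, from which linearity
    follows. *)
Lemma mlinE b p : (msize p <= b)%N ->
  mlin p = \sum_(mo : 'X_{1..n < b}) p@_mo *: g mo.
Proof.
move=> le_pb; rewrite /mlin (big_mksub ('X_{1..n < b} : subFinType _)) ?msupp_uniq //=.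
  by rewrite big_rmcond //= => j /memN_msupp_eq0 ->; rewrite scale0r.
by move=> x /msize_mdeg_lt /leq_trans; apply.
Qed.

Lemma mlin_is_linear : linear mlin.
Proof.
move=> c p q; pose b := maxn (msize (c *: p + q)) (maxn (msize p) (msize q)).
rewrite !(@mlinE b) ?leq_max ?leqnn ?orbT // scaler_sumr -big_split /=.
by apply: eq_bigr => mo _; rewrite mcoeffD mcoeffZ scalerDl scalerA.
Qed.

HB.instance Definition _ := GRing.isLinear.Build k {mpoly k[n]} V _ mlin mlin_is_linear.

Lemma mlinX mo : mlin 'X_[mo] = g mo.
Proof. by rewrite /mlin msuppX big_seq1 mcoeffX eqxx scale1r. Qed.

End LinearExtension.

(** * Separation by linear functionals *)

Section Functional.
Variables (k : fieldType) (n : nat).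

(** Only finitely many monomials occur, so this is a statement about row vectors: a row outside the
    row space of a matrix is detected by its cokernel. *)
Lemma span_or_functional (a : {mpoly k[n]}) (Z : seq {mpoly k[n]}) :
  (exists c : nat -> k, a = \sum_(0 <= i < size Z) c i *: Z`_i) \/
  (exists lam : 'X_{1..n} -> k^o, mlin lam a != 0 /\ forall z, z \in Z -> mlin lam z = 0).
Proof.
pose b := maxn (msize a) (\max_(z <- Z) msize z).
have bZ z : z \in Z -> (msize z <= b)%N.
  move=> zZ; rewrite leq_max; apply/orP; right.
  exact: (@leq_bigmax_seq _ _ xpredT (fun z : {mpoly k[n]} => msize z)).
have ba : (msize a <= b)%N by rewrite leq_max leqnn.
pose row_of (p : {mpoly k[n]}) : 'rV[k]_(#|{: 'X_{1..n < b}}|) :=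
  \row_j p@_(enum_val j : 'X_{1..n < b}).
pose M := \matrix_(i < size Z) row_of Z`_i.
have [/submxP[c cP]|] := boolP (row_of a <= M)%MS.
  left; exists (fun i => if insub i is Some i' then c 0 i' else 0).
  rewrite big_mkord; under eq_bigr do rewrite valK; apply/mpolyP => mo.
  have [mob|mob] := ltnP (mdeg mo) b.
    have /matrixP/(_ 0 (enum_rank (BMultinom mob))) := cP.
    rewrite !mxE enum_rankK /= => ->; rewrite raddf_sum /=.
    by apply: eq_bigr => i _; rewrite !mxE enum_rankK mcoeffZ.
  rewrite raddf_sum /= memN_msupp_eq0 ?big1 //.
    move=> i _; rewrite mcoeffZ memN_msupp_eq0 ?mulr0 //.
    by apply/msize_mdeg_ge/(leq_trans _ mob)/bZ/mem_nth.
  by apply/msize_mdeg_ge/(leq_trans _ mob).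
(* Column [j] of the cokernel matrix is the functional: it kills every row of [M] but not the row of
   [a]. It is extended by 0 to monomials beyond the bound. *)
rewrite submxE => /matrix0Pn[i [j hj]]; right.
pose lam (mo : 'X_{1..n}) : k^o :=
  if insub mo is Some mo' then cokermx M (enum_rank (mo' : 'X_{1..n < b})) j else 0.
have lamE (p : {mpoly k[n]}) : (msize p <= b)%N ->
    mlin lam p = (row_of p *m cokermx M) 0 j.
  move=> pb; rewrite (mlinE _ pb) mxE.
  rewrite (reindex (fun x : 'I_(#|{: 'X_{1..n < b}}|) => enum_val x)) /=; last first.
    exact/onW_bij/enum_val_bij.
  by apply: eq_bigr => x _; rewrite [row_of p 0 x]mxE /lam valK enum_valK.
exists lam; split; first by rewrite lamE // -(ord1 i).
move=> z zZ; rewrite lamE ?bZ //.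
have zi : (index z Z < size Z)%N by rewrite index_mem.
have -> : row_of z = row (Ordinal zi) M by rewrite rowK /= nth_index.
by rewrite -row_mul mulmx_coker row0 mxE.
Qed.

End Functional.

(** * Joins of kernels *)

Section TensorKernel.
Variables (k : fieldType).

Section Shifts.
Variables (N1 N2 : nat).

(** The ring in [N1 + N2] variables serves as the tensor product; [lft] and [rgt] are the inclusions
    of its two factors. *)
Definition lft : {mpoly k[N1]} -> {mpoly k[N1 + N2]} :=
  subst (fun i => 'X_(lshift N2 i)).
Definition rgt : {mpoly k[N2]} -> {mpoly k[N1 + N2]} :=
  subst (fun i => 'X_(rshift N1 i)).
HB.instance Definition _ := GRing.RMorphism.on lft.
HB.instance Definition _ := GRing.RMorphism.on rgt.

Definition lmnm (mo : 'X_{1..N1 + N2}) : 'X_{1..N1} := [multinom mo (lshift N2 i) | i < N1].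
Definition rmnm (mo : 'X_{1..N1 + N2}) : 'X_{1..N2} := [multinom mo (rshift N1 i) | i < N2].
Definition cmnm (m1 : 'X_{1..N1}) (m2 : 'X_{1..N2}) : 'X_{1..N1 + N2} :=
  [multinom match split i with inl a => m1 a | inr a => m2 a end | i < N1 + N2].

Lemma mpolyX_cmnm m1 m2 : 'X_[cmnm m1 m2] = lft 'X_[m1] * rgt 'X_[m2].
Proof.
rewrite /lft /rgt !substXm mpolyXE_id big_split_ord /=; congr (_ * _).
  by apply: eq_bigr => i _; rewrite mnmE (unsplitK (inl _ i)).
by apply: eq_bigr => i _; rewrite mnmE (unsplitK (inr _ i)).
Qed.

Lemma cmnmK mo : cmnm (lmnm mo) (rmnm mo) = mo.
Proof.
apply/mnmP => i; rewrite mnmE; case: split_ordP => j ->; by rewrite mnmE.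
Qed.

Lemma lmnmK m1 m2 : lmnm (cmnm m1 m2) = m1.
Proof. by apply/mnmP => i; rewrite !mnmE (unsplitK (inl _ i)). Qed.

Lemma rmnmK m1 m2 : rmnm (cmnm m1 m2) = m2.
Proof. by apply/mnmP => i; rewrite !mnmE (unsplitK (inr _ i)). Qed.

Lemma tensor_decomp (q : {mpoly k[N1 + N2]}) :
  exists s : seq ({mpoly k[N1]} * {mpoly k[N2]}), q = \sum_(x <- s) lft x.1 * rgt x.2.
Proof.
exists [seq (q@_mo *: 'X_[lmnm mo], 'X_[rmnm mo]) | mo <- msupp q].
rewrite big_map {1}[q]mpolyE; apply: eq_bigr => mo _ /=.
by rewrite /lft substZ -scalerAl -mpolyX_cmnm cmnmK.
Qed.

(** Contraction of the first tensor factor with the functional [mlin lam]. *)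
Definition slice (lam : 'X_{1..N1} -> k^o) : {mpoly k[N1 + N2]} -> {mpoly k[N2]} :=
  mlin (fun mo => (lam (lmnm mo) : k) *: 'X_[rmnm mo]).
HB.instance Definition _ lam := GRing.Linear.on (slice lam).

Lemma sliceM lam a g : slice lam (lft a * rgt g) = (mlin lam a : k) *: g.
Proof.
rewrite [a in LHS]mpolyE [g in LHS]mpolyE !rmorph_sum big_distrlr /= linear_sum.
rewrite /mlin scaler_suml; apply: eq_bigr => m1 _.
rewrite linear_sum [g in RHS]mpolyE scaler_sumr; apply: eq_bigr => m2 _.
rewrite /lft /rgt !substZ -scalerAl -scalerAr -mpolyX_cmnm !linearZ /=.
rewrite /slice mlinX lmnmK rmnmK !scalerA /= -!mulrA; congr (_ *: _).
exact: mulrCA.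
Qed.

(** The quotient by the ideal these generate is the tensor product of the quotients by the ideals of
    [S1] and [S2]. *)
Definition lr_gens (S1 : polyset k N1) (S2 : polyset k N2) : polyset k (N1 + N2) :=
  fun q => (exists a, S1 a /\ q = lft a) \/ (exists b, S2 b /\ q = rgt b).

Lemma lr_lft S1 S2 a c : in_ideal_gen S1 a -> in_ideal_gen (lr_gens S1 S2) (c * lft a).
Proof.
move=> h; apply: idealM; apply: subst_ideal h => p Sp.
by apply: ideal_gen; left; exists p.
Qed.

Lemma lr_rgt S1 S2 b c : in_ideal_gen S2 b -> in_ideal_gen (lr_gens S1 S2) (c * rgt b).
Proof.
move=> h; apply: idealM; apply: subst_ideal h => p Sp.
by apply: ideal_gen; right; exists p.
Qed.

Lemma lr_decomp S1 S2 q : in_ideal_gen (lr_gens S1 S2) q ->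
  exists s t : seq ({mpoly k[N1]} * {mpoly k[N2]}),
    [/\ forall x, x \in s -> in_ideal_gen S1 x.1,
        forall x, x \in t -> in_ideal_gen S2 x.2
      & q = \sum_(x <- s) lft x.1 * rgt x.2 + \sum_(x <- t) lft x.1 * rgt x.2].
Proof.
move: q; apply: ideal_min => [|p q [s [t [hs ht ->]]] [s' [t' [hs' ht' ->]]]|c p].
- by exists [::], [::]; split=> //; rewrite !big_nil addr0.
- exists (s ++ s'), (t ++ t'); split.
  + by move=> x; rewrite mem_cat => /orP[/hs|/hs'].
  + by move=> x; rewrite mem_cat => /orP[/ht|/ht'].
  + by rewrite !big_cat /= addrACA.
have [u ->] := tensor_decomp c; case=> [[a [Sa ->]]|[b [Sb ->]]].
- exists [seq (x.1 * a, x.2) | x <- u], [::]; split=> //.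
    by move=> _ /mapP[x _ ->]; apply: idealM; apply: ideal_gen.
  rewrite big_nil addr0 big_map mulr_suml; apply: eq_bigr => x _.
  by rewrite /= rmorphM mulrAC.
- exists [::], [seq (x.1, x.2 * b) | x <- u]; split=> //.
    by move=> _ /mapP[x _ ->]; apply: idealM; apply: ideal_gen.
  rewrite big_nil add0r big_map mulr_suml; apply: eq_bigr => x _.
  by rewrite /= rmorphM mulrA.
Qed.

End Shifts.

Section Kernel.
Variables (D1 D2 N1 N2 : nat) (v1 : 'I_D1 -> {mpoly k[N1]}) (v2 : 'I_D2 -> {mpoly k[N2]}).
Variables (S1 : polyset k N1) (S2 : polyset k N2).

Definition tmap : {mpoly k[D1 + D2]} -> {mpoly k[N1 + N2]} :=
  subst (fun i => match split i with inl a => lft N2 (v1 a) | inr a => rgt N1 (v2 a) end).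
HB.instance Definition _ := GRing.RMorphism.on tmap.

Lemma tmap_lft p : tmap (lft D2 p) = lft N2 (subst v1 p).
Proof.
rewrite /tmap /lft !subst_comp; apply: subst_eq => i.
by rewrite substX (unsplitK (inl _ i)).
Qed.

Lemma tmap_rgt p : tmap (rgt D1 p) = rgt N1 (subst v2 p).
Proof.
rewrite /tmap /rgt !subst_comp; apply: subst_eq => i.
by rewrite substX (unsplitK (inr _ i)).
Qed.

Let A : polyset k D1 := fun p => in_ideal_gen S1 (subst v1 p).
Let B : polyset k D2 := fun p => in_ideal_gen S2 (subst v2 p).

(* Induction on the number of terms of q = sum_i x_i (x) y_i: either the image of
   x_0 depends on the others, and q can be shortened, or a linear functional that
   isolates it shows that y_0 is in the second kernel. *)
Lemma tmap_kernel q :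
  in_ideal_gen (lr_gens A B) q <-> in_ideal_gen (lr_gens S1 S2) (tmap q).
Proof.
split.
  apply: subst_ideal => _ [[a [Aa ->]]|[b [Bb ->]]].
    by rewrite -/(tmap _) tmap_lft -[lft _ _]mul1r; exact: lr_lft.
  by rewrite -/(tmap _) tmap_rgt -[rgt _ _]mul1r; exact: lr_rgt.
have [s ->] := tensor_decomp q.
have [m] := ubnP (size s); elim: m s => // m IH [|x s] sm.
  by rewrite big_nil => _; exact: ideal0.
rewrite big_cons rmorphD /= => hq.
have [si [tj [hsi htj E]]] := lr_decomp hq.
(* The left factors of [si] lie in the ideal of [S1]; including them makes the dependence one modulo
   that ideal. *)
pose Z := [seq subst v1 y.1 | y <- s] ++ [seq y.1 | y <- si].
have [[c cP]|[lam [lamx lamZ]]] := span_or_functional (subst v1 x.1) Z.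
  (* The first left factor is replaced by [i0], which lies in [A]; the multiples of [x.2] thereby
     released are absorbed in the right factors of the other terms, so [s'] is one term shorter. *)
  pose s' := [seq ((nth 0 s i).1, (nth 0 s i).2 + c i *: x.2) | i <- iota 0 (size s)].
  pose i0 := x.1 - \sum_(0 <= i < size s) c i *: (nth 0 s i).1.
  have Ai0 : A i0.
    rewrite /A /i0 rmorphB rmorph_sum /= cP size_cat size_map.
    rewrite (@big_cat_nat _ _ _ (size s)) //= ?leq_addr //.
    rewrite addrAC -sumrB [X in X + _]big_nat.
    rewrite [X in X + _]big1 ?add0r => [|i /= i_s]; last first.
      rewrite substZ nth_cat size_map i_s (nth_map 0) //; exact: subrr.
    rewrite big_nat; apply: ideal_sum => i _ /andP[si_i i_lt]; apply: idealZ.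
    rewrite nth_cat size_map ltnNge si_i /=.
    have i_s : (i - size s < size si)%N by rewrite ltn_subLR // -(size_map fst si).
    by rewrite (nth_map 0) //; apply: hsi; exact: mem_nth.
  have Eq : lft D2 x.1 * rgt D1 x.2 + \sum_(y <- s) lft D2 y.1 * rgt D1 y.2 =
      rgt D1 x.2 * lft D2 i0 + \sum_(y <- s') lft D2 y.1 * rgt D1 y.2.
    rewrite big_map /i0 rmorphB rmorph_sum mulrBr mulrC -addrA; congr (_ + _).
    rewrite (big_nth 0) /index_iota subn0 mulr_sumr.
    rewrite addrC -sumrB; apply: eq_bigr => i _.
    rewrite rmorphD /= mulrDr /lft /rgt !substZ -scalerAr -scalerAr.
    by rewrite [subst _ x.2 * _]mulrC addrK.
  rewrite Eq; apply: idealD; first by apply: lr_lft; exact: ideal_gen.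
  apply: IH; first by rewrite size_map size_iota.
  have -> : \sum_(y <- s') lft D2 y.1 * rgt D1 y.2 =
    (lft D2 x.1 * rgt D1 x.2 + \sum_(y <- s) lft D2 y.1 * rgt D1 y.2) - rgt D1 x.2 * lft D2 i0.
    by rewrite Eq addrAC subrr add0r.
  rewrite rmorphB /=; apply: idealB; first by rewrite rmorphD.
  by rewrite rmorphM /= tmap_lft; exact: lr_lft.
(* Contracting with [lam] kills all other terms and the whole sum over [si]; a nonzero multiple of
   [subst v2 x.2] remains, equal to an element of the ideal of [S2]. *)
have Bx : B x.2.
  have : slice lam (tmap (lft D2 x.1 * rgt D1 x.2) +
      tmap (\sum_(y <- s) lft D2 y.1 * rgt D1 y.2)) = mlin lam (subst v1 x.1) *: subst v2 x.2.
    rewrite linearD /= rmorphM /= tmap_lft tmap_rgt sliceM -[RHS]addr0; congr (_ + _).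
    rewrite rmorph_sum (linear_sum (slice lam)) /= big_seq; apply: big1 => y ys.
    rewrite rmorphM /= tmap_lft tmap_rgt sliceM lamZ ?scale0r //.
    by rewrite mem_cat (map_f (fun y => subst v1 y.1) ys).
  rewrite E linearD /= !(linear_sum (slice lam)) /=.
  rewrite [X in X + _ = _]big_seq [X in X + _ = _]big1 ?add0r => [|y ys]; last first.
    by rewrite sliceM lamZ ?scale0r // mem_cat (map_f fst ys) orbT.
  move=> /(congr1 (fun z => (mlin lam (subst v1 x.1))^-1 *: z)).
  rewrite scalerA mulVf // scale1r /B => <-; apply: idealZ.
  by apply: ideal_sum => y ys _; rewrite sliceM; apply: idealZ; exact: htj.
apply: idealD; first by apply: lr_rgt; exact: ideal_gen.
apply: IH => //.
have -> : tmap (\sum_(y <- s) lft D2 y.1 * rgt D1 y.2) =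
  (tmap (lft D2 x.1 * rgt D1 x.2) + tmap (\sum_(y <- s) lft D2 y.1 * rgt D1 y.2))
   - tmap (lft D2 x.1 * rgt D1 x.2) by rewrite addrAC subrr add0r.
apply: idealB => //; rewrite rmorphM /= tmap_rgt; exact: lr_rgt.
Qed.

End Kernel.

(** Comultiplication followed by the tensor product of the two maps sends the [j]-th variable to the
    sum of its two images, so a join of kernels is again a kernel. *)
Lemma join_kernel (D N1 N2 : nat) (v1 : 'I_D -> {mpoly k[N1]}) (v2 : 'I_D -> {mpoly k[N2]})
    (S1 : polyset k N1) (S2 : polyset k N2) (p : {mpoly k[D]}) :
  join (fun p => in_ideal_gen S1 (subst v1 p)) (fun p => in_ideal_gen S2 (subst v2 p)) p <->
  in_ideal_gen (lr_gens S1 S2) (subst (fun j => lft N2 (v1 j) + rgt N1 (v2 j)) p).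
Proof.
have -> : subst (fun j => lft N2 (v1 j) + rgt N1 (v2 j)) p =
    tmap v1 v2 (subst (fun j => yvar k j + zvar k j) p).
  rewrite /tmap subst_comp; apply: subst_eq => j; rewrite rmorphD /= !substX.
  by rewrite (unsplitK (inl _ j)) (unsplitK (inr _ j)).
exact: tmap_kernel.
Qed.

End TensorKernel.

(** * Words of monomials *)

Section Words.
Variable n : nat.
Notation word := (seq 'X_{1..n}).
Implicit Types (u v w h : word) (a b f : 'X_{1..n}).

Definition wle u v : bool := ((u : seqlexi 'X_{1..n}) <= v)%O.
Definition wlt u v : bool := ((u : seqlexi 'X_{1..n}) < v)%O.

Lemma wlt_cons a b u v : wlt (a :: u) (b :: v) = (a < b)%O || (a == b) && wlt u v.
Proof. rewrite /wlt ltxi_cons. by case: (ltgtP a b). Qed.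

Definition ins (pos : nat) f w := take pos w ++ f :: drop pos w.

Lemma size_ins pos f w : size (ins pos f w) = (size w).+1.
Proof. by rewrite size_cat /= addnS -size_cat cat_take_drop. Qed.

Lemma wlt_ins pos f u v : size u = size v -> wlt u v -> wlt (ins pos f u) (ins pos f v).
Proof.
elim: pos u v => [|pos IH] [|a u] [|b v] //=.
- by move=> _ uv; rewrite /ins /= wlt_cons eqxx uv orbT.
- move=> [uv]; rewrite -/(ins pos f u) -/(ins pos f v) !wlt_cons.
  by case/orP=> [->//|/andP[-> /IH->]]; rewrite ?orbT.
Qed.

Definition wmul h u : word := [seq (x.1 + x.2)%MM | x <- zip h u].

Lemma size_wmul h u : size h = size u -> size (wmul h u) = size u.
Proof. by move=> hu; rewrite size_map size_zip hu minnn. Qed.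

(** The monomial order on letters is invariant under multiplication, so the first difference keeps
    its place and its sign. *)
Lemma wlt_wmul h u v : size h = size u -> size h = size v -> wlt u v ->
  wlt (wmul h u) (wmul h v).
Proof.
elim: h u v => [|c h IH] [|a u] [|b v] //= [hu] [hv].
rewrite /wmul /= -/(wmul h u) -/(wmul h v) !wlt_cons ltmc_add2r eqm_add2l.
by case/orP=> [->//|/andP[-> /IH->]]; rewrite ?orbT.
Qed.

Notation wemb := (hemb (fun a b : 'X_{1..n} => (a <= b)%MM)).

(** For lack of letters in [u], some letter of [w] is unmatched, and deleting it keeps the
    embedding. *)
Lemma wemb_ins u w : wemb u w -> (size u < size w)%N ->
  exists pos f w', [/\ (pos <= size w')%N, w = ins pos f w' & wemb u w'].
Proof.
elim=> [[|a w'] //= _|u' w' a uw _ _|u' w' a b ab uw IH /=].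
- by exists 0%N, a, w'; split=> //; [rewrite /ins take0 drop0|exact: hemb_nil].
- by exists 0%N, a, w'; split=> //; rewrite /ins take0 drop0.
- rewrite ltnS => /IH[pos [f [w'' [posw -> uw'']]]].
  by exists pos.+1, f, (b :: w''); split=> //; exact: hemb_cons.
Qed.

(** Equal lengths leave no room for a skipped letter, so the embedding is letterwise divisibility
    and [h] collects the quotients. *)
Lemma wemb_wmul u w : wemb u w -> size u = size w ->
  exists h, size h = size u /\ w = wmul h u.
Proof.
elim=> [[|//] _|u' w' a uw _ /= E|u' w' a b ab uw IH /= [E]].
- by exists [::].
- by have := hemb_size uw; rewrite E ltnn.
- have [h [hu ->]] := IH E; exists ((b - a)%MM :: h); split; first by rewrite /= hu.
  by rewrite /wmul /= submK.
Qed.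

Variables (m : nat) (blk : 'I_n -> 'I_m).

Lemma bdegD a b i : bdeg blk (a + b)%MM i = (bdeg blk a i + bdeg blk b i)%N.
Proof. by rewrite /bdeg -big_split; apply: eq_bigr => j _; rewrite mnmDE. Qed.

Lemma sum_bdeg a : (\sum_i bdeg blk a i)%N = mdeg a.
Proof.
rewrite mdegE /bdeg (exchange_big_dep xpredT) //=; apply: eq_bigr => j _.
by rewrite (big_pred1 (blk j)) // => i; rewrite eq_sym.
Qed.

Definition has_bdeg (d : 'I_m -> nat) a := [forall i, bdeg blk a i == d i].

Lemma has_bdegP d a : reflect (forall i, bdeg blk a i = d i) (has_bdeg d a).
Proof. exact: eqfunP. Qed.

Definition wvalid (d : 'I_m -> nat) w := all (has_bdeg d) w.

Lemma wvalid_ins d pos f w : wvalid d (ins pos f w) = has_bdeg d f && wvalid d w.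
Proof.
by rewrite /wvalid all_cat /= andbCA -all_cat cat_take_drop.
Qed.

(** The word [u] shows that every letter of [h] has multidegree [d - d0]; hence [h] also carries
    [u'] from [d0] to [d]. *)
Lemma wvalid_wmul d0 d h u u' : size h = size u -> size h = size u' ->
  wvalid d0 u -> wvalid d0 u' -> wvalid d (wmul h u) -> wvalid d (wmul h u').
Proof.
elim: h u u' => [|c h IH] [|a u] [|b u'] //= [hu] [hu'].
move=> /andP[/has_bdegP a0 u0] /andP[/has_bdegP b0 u'0].
rewrite /wmul /= => /andP[/has_bdegP cd hd]; apply/andP; split; last exact: (IH u).
by apply/has_bdegP => i; rewrite -cd !bdegD a0 b0.
Qed.

(** The multidegree bounds the total degree of each letter. The list is decreasing, so that the
    division algorithm meets the largest word first. *)
Lemma wvalid_finite d e : exists S : seq word,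
  [/\ uniq S, sorted (fun u v => wle v u) S
    & forall w, size w = e -> wvalid d w -> w \in S].
Proof.
pose b := (\sum_i d i).+1.
pose l := [seq [seq bmnm a | a : 'X_{1..n < b} <- tval t]
  | t : e.-tuple 'X_{1..n < b} <- enum {: e.-tuple 'X_{1..n < b}}].
exists (sort (fun u v => wle v u) (undup l)); split.
- by rewrite sort_uniq undup_uniq.
- by apply: sort_sorted => u v; exact: le_total.
move=> w we wd; rewrite mem_sort mem_undup; apply/mapP.
have te : size [seq insubd (@bm0 n (\sum_i d i)) a | a <- w] == e by rewrite size_map we.
exists (Tuple te); first by rewrite mem_enum.
rewrite /= -map_comp -[LHS]map_id; apply/eq_in_map => a aw /=.
rewrite insubdK // unfold_in /= ltnS -sum_bdeg leq_sum // => i _.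
by have /has_bdegP -> := allP wd _ aw.
Qed.

End Words.

(** * Tensors *)

Section Tensors.
Variables (k : fieldType) (n : nat).
Notation word := (seq 'X_{1..n}).
Notation tens := (seq (k * seq 'X_{1..n})).
Implicit Types (F G : tens) (u v w : word).

(** Tensors are unreduced lists of weighted words. Two of them count as equal when all [tcoef]
    agree, and [tcoef_lin] shows that linear extensions respect this. *)
Definition tlin (V : lmodType k) (g : word -> V) F : V := \sum_(x <- F) x.1 *: g x.2.

Definition tcoef F w : k := tlin (fun u => ((u == w)%:R : k^o)) F.

Definition tscale (c : k) F : tens := [seq (c * x.1, x.2) | x <- F].

Definition tmapw (h : word -> word) F : tens := [seq (x.1, h x.2) | x <- F].

Lemma tlin_cat (V : lmodType k) (g : word -> V) F G : tlin g (F ++ G) = tlin g F + tlin g G.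
Proof. by rewrite /tlin big_cat. Qed.

Lemma tlin_scale (V : lmodType k) (g : word -> V) c F : tlin g (tscale c F) = c *: tlin g F.
Proof. by rewrite /tlin big_map scaler_sumr; apply: eq_bigr => x _; rewrite scalerA. Qed.

Lemma tlin_map (V : lmodType k) (g : word -> V) h F : tlin g (tmapw h F) = tlin (g \o h) F.
Proof. by rewrite /tlin big_map. Qed.

Lemma tlin_coef (V : lmodType k) (g : word -> V) F (s : seq word) : uniq s ->
  (forall x, x \in F -> x.2 \in s) -> tlin g F = \sum_(w <- s) tcoef F w *: g w.
Proof.
move=> us Fs; rewrite /tcoef /tlin; under [RHS]eq_bigr do rewrite scaler_suml.
rewrite exchange_big /=; apply: eq_big_seq => x xF.
rewrite (bigD1_seq x.2) ?Fs //= eqxx big1 ?addr0; last first.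
  by move=> w; rewrite eq_sym => /negPf->; rewrite scaler0 scale0r.
by rewrite -[_ *: 1]/(_ * 1) mulr1.
Qed.

Lemma tcoef_lin (V : lmodType k) (g : word -> V) F G :
  tcoef F =1 tcoef G -> tlin g F = tlin g G.
Proof.
move=> FG; pose s := undup (map snd (F ++ G)).
rewrite !(@tlin_coef _ _ _ s) ?undup_uniq // => [|x xG|x xF].
- by apply: eq_bigr => w _; rewrite FG.
- by rewrite mem_undup map_f // mem_cat xG orbT.
- by rewrite mem_undup map_f // mem_cat xF.
Qed.

Lemma tcoef_mem F w : tcoef F w != 0 -> exists2 x, x \in F & x.2 = w.
Proof.
move=> h; apply: NNPP => nx; move: h; rewrite /tcoef /tlin big_seq big1 ?eqxx //.
move=> x xF; case: eqP => [E|]; last by rewrite scaler0.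
by case: nx; exists x.
Qed.

Lemma tcoef_cat F G w : tcoef (F ++ G) w = tcoef F w + tcoef G w.
Proof. exact: (@tlin_cat k^o). Qed.

Lemma tcoef_scale c F w : tcoef (tscale c F) w = c * tcoef F w.
Proof. exact: (@tlin_scale k^o). Qed.

Definition lead F w := tcoef F w != 0 /\ forall w', wlt w w' -> tcoef F w' = 0.

(** Being strictly increasing on words of length [e], [h] is injective there, so no terms merge and
    the largest word stays the largest. *)
Lemma lead_map (h : word -> word) e F w :
  (forall x, x \in F -> size x.2 = e) -> size w = e ->
  (forall u v, size u = e -> size v = e -> wlt u v -> wlt (h u) (h v)) ->
  lead F w -> lead (tmapw h F) (h w).
Proof.
move=> Fe we hmono [Fw Flt].
have hinj u v : size u = e -> size v = e -> (h u == h v) = (u == v).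
  move=> ue ve; apply/eqP/eqP => [E|->//].
  have : ~~ wlt u v by apply/negP => /(hmono _ _ ue ve); rewrite E /wlt ltxx.
  have : ~~ wlt v u by apply/negP => /(hmono _ _ ve ue); rewrite E /wlt ltxx.
  by rewrite /wlt; case: (ltgtP (u : seqlexi 'X_{1..n}) v).
have cE u : size u = e -> tcoef (tmapw h F) (h u) = tcoef F u.
  move=> ue; rewrite /tcoef tlin_map /tlin; apply: eq_big_seq => x xF /=.
  by rewrite hinj // Fe.
split; first by rewrite cE.
move=> w' hw'; apply/eqP; apply: contraT => nz.
have [_ /mapP[x xF ->] /= E] := tcoef_mem nz.
move: nz hw'; rewrite -E cE ?Fe // => nz hw'.
suff wx : wlt w x.2 by rewrite Flt ?eqxx in nz.
move: hw'; rewrite /wlt; case: (ltgtP (w : seqlexi 'X_{1..n}) x.2) => // [xw|->].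
  by rewrite ltNge ltW // [(_ < _)%O]hmono ?Fe.
by rewrite ltxx.
Qed.

End Tensors.

(** * Functions on tuples of points with few distinct entries *)

Section SecantModule.
Variables (k : fieldType) (n m : nat) (blk : 'I_n -> 'I_m) (r N : nat).
Variables (L : polyset k N) (X : 'I_r -> 'X_{1..n} -> {mpoly k[N]}).
Hypothesis LD : forall p q, L p -> L q -> L (p + q).
Hypothesis LM : forall a p, L p -> L (a * p).
Hypothesis XD : forall s a b, X s (a + b)%MM = X s a * X s b.
Notation word := (seq 'X_{1..n}).
Notation tens := (seq (k * seq 'X_{1..n})).
Notation wemb := (hemb (fun a b : 'X_{1..n} => (a <= b)%MM)).
Implicit Types (F G : tens) (u v w h : word) (phi : seq 'I_r) (d : 'I_m -> nat).

(** The word as a function on tuples of points: its letter in each place is evaluated at the point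
    that [phi] names there. *)
Definition ev phi w : {mpoly k[N]} := \prod_(x <- zip phi w) X x.1 x.2.

(* The multidegree (d, ..., d) part of the ideal of those e-tuples of points
   of which at most r are distinct: phi says which entries coincide. *)
Definition secmod d e F :=
  (forall x, x \in F -> size x.2 = e /\ wvalid blk d x.2) /\
  (forall phi, size phi = e -> L (tlin (ev phi) F)).

Lemma LZ c p : L p -> L (c *: p).
Proof. by rewrite -mul_mpolyC; exact: LM. Qed.

Lemma secmod_cat d e F G : secmod d e F -> secmod d e G -> secmod d e (F ++ G).
Proof.
move=> [F1 F2] [G1 G2]; split=> [x|phi phie].
  by rewrite mem_cat => /orP[/F1|/G1].
by rewrite tlin_cat; apply: LD; auto.
Qed.

Lemma secmod_scale d e c F : secmod d e F -> secmod d e (tscale c F).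
Proof.
move=> [F1 F2]; split=> [_ /mapP[x xF ->]|phi phie]; first exact: (F1 _ xF).
by rewrite tlin_scale; apply: LZ; auto.
Qed.

(** Dropping the entry [s] of [phi] at [pos] leaves a tuple for [F], whose value is merely
    multiplied by [X s f]. *)
Lemma secmod_ins d e F pos f : (pos <= e)%N -> has_bdeg blk d f ->
  secmod d e F -> secmod d e.+1 (tmapw (ins pos f) F).
Proof.
move=> pe fd [F1 F2]; split=> [_ /mapP[x xF ->] /=|phi phie].
  by have [sx vx] := F1 _ xF; rewrite size_ins sx wvalid_ins fd.
rewrite tlin_map; have := size_drop pos phi; rewrite phie subSn //.
case E : (drop pos phi) => [//|s phi2] /= [phi2e].
have phiE : phi = take pos phi ++ s :: phi2 by rewrite -E cat_take_drop.
have tE : size (take pos phi) = pos by rewrite size_takel // phie ltnW.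
have -> : tlin (ev phi \o ins pos f) F = X s f * tlin (ev (take pos phi ++ phi2)) F.
  rewrite /tlin mulr_sumr; apply: eq_big_seq => x xF; rewrite -scalerAr; congr (_ *: _).
  have [sx _] := F1 _ xF; have tx : size (take pos phi) = size (take pos x.2).
    by rewrite tE size_takel // sx.
  rewrite /= {1}phiE /ev /ins zip_cat // big_cat /= big_cons /= mulrCA; congr (_ * _).
  by rewrite -[x.2 in RHS](cat_take_drop pos) zip_cat // big_cat.
by apply/LM/F2; rewrite size_cat tE phi2e subnKC.
Qed.

Lemma ev_wmul phi h u : size h = size u -> ev phi (wmul h u) = ev phi h * ev phi u.
Proof.
elim: phi h u => [|s phi IH] [|a h] [|b u] //= hu; rewrite /ev /= ?big_nil ?mulr1 //.
case: hu => hu; rewrite !big_cons /= -!/(ev _ _) IH // XD; exact: mulrACA.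
Qed.

(** All values on [phi] acquire the common factor [ev phi h]. *)
Lemma secmod_wmul d0 d e F h : size h = e ->
  (forall x, x \in F -> wvalid blk d (wmul h x.2)) ->
  secmod d0 e F -> secmod d e (tmapw (wmul h) F).
Proof.
move=> he hF [F1 F2]; split=> [_ /mapP[x xF ->] /=|phi phie].
  by have [sx vx] := F1 _ xF; rewrite size_wmul ?sx ?he //; split=> //; exact: hF.
rewrite tlin_map.
have -> : tlin (ev phi \o wmul h) F = ev phi h * tlin (ev phi) F.
  rewrite /tlin mulr_sumr; apply: eq_big_seq => x xF; rewrite -scalerAr; congr (_ *: _).
  by have [sx _] := F1 _ xF; rewrite /= ev_wmul // sx.
by apply/LM/F2.
Qed.

Definition lead_word d w := exists F, secmod d (size w) F /\ lead F w.

Lemma lead_word_valid d w : lead_word d w -> wvalid blk d w.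
Proof.
by move=> [F [[F1 _] [/tcoef_mem[x xF <-] _]]]; have [] := F1 _ xF.
Qed.

Lemma lead_word_ins d w pos f : (pos <= size w)%N -> has_bdeg blk d f ->
  lead_word d w -> lead_word d (ins pos f w).
Proof.
move=> pw fd [F [Fsec Fw]]; exists (tmapw (ins pos f) F); split.
  by rewrite size_ins; exact: secmod_ins.
apply: (@lead_map _ _ _ (size w)) => // [x xF|u v us vs].
  by have [] := Fsec.1 _ xF.
by apply: wlt_ins; rewrite us vs.
Qed.

Lemma lead_word_wmul d0 d u h : size h = size u -> wvalid blk d (wmul h u) ->
  lead_word d0 u -> lead_word d (wmul h u).
Proof.
move=> hu vhu Lu; have uv := lead_word_valid Lu.
have [F [Fsec Fu]] := Lu; exists (tmapw (wmul h) F); split.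
  rewrite size_wmul //; apply: (secmod_wmul _ _ Fsec) => // x xF.
  have [sx vx] := Fsec.1 _ xF.
  by apply: (wvalid_wmul _ _ uv vx vhu); rewrite ?sx.
apply: (@lead_map _ _ _ (size u)) => // [x xF|v v' vs vs'].
  by have [] := Fsec.1 _ xF.
by apply: wlt_wmul; rewrite ?vs ?vs'.
Qed.

(** Unmatched letters of [w] are accounted for by insertions, and what is left is a letterwise
    multiple of [u]. As [d0] and [d] may differ, all multidegrees are treated at once. *)
Lemma lead_word_emb d0 d u w : wemb u w -> wvalid blk d w ->
  lead_word d0 u -> lead_word d w.
Proof.
have [e] := ubnP (size w); elim: e w => // e IH w we uw wd Lu.
have := hemb_size uw; rewrite leq_eqVlt => /orP[/eqP E|uws].
  have [h [hu wE]] := wemb_wmul uw E; rewrite wE in wd *; exact: lead_word_wmul Lu.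
have [pos [f [w' [posw wE uw']]]] := wemb_ins uw uws.
rewrite wE wvalid_ins in wd *; case/andP: wd => fd w'd; apply: lead_word_ins => //.
by apply: IH => //; rewrite -ltnS -(size_ins pos f) -wE.
Qed.

(** Otherwise there are arbitrarily long leading words into which no shorter leading word, of any
    multidegree, embeds; this contradicts Higman's lemma. *)
Lemma lead_word_bound : exists C, forall d w, (C < size w)%N -> lead_word d w ->
  exists pos f w', [/\ (pos <= size w')%N, has_bdeg blk d f, w = ins pos f w'
    & lead_word d w'].
Proof.
have [C CP] : exists C, forall d w, (C < size w)%N -> lead_word d w ->
    exists d0 u, [/\ lead_word d0 u, wemb u w & (size u < size w)%N].
  apply: NNPP => nC.
  have [W WP] : exists W : nat -> word, forall C, (C < size (W C))%N /\
      exists d, lead_word d (W C) /\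
      forall d0 u, lead_word d0 u -> wemb u (W C) -> (size u < size (W C))%N -> False.
    apply: (functional_choice (fun C w => (C < size w)%N /\
      exists d, lead_word d w /\
      forall d0 u, lead_word d0 u -> wemb u w -> (size u < size w)%N -> False)) => C.
    apply: NNPP => nw; apply: nC; exists C => d w Cw Lw; apply: NNPP => nu.
    apply: nw; exists w; split=> //; exists d; split=> // d0 u Lu uw uws.
    by apply: nu; exists d0, u.
  (* Lengths strictly increase along [f], so an embedding between two of its terms comes from a
     strictly shorter word. *)
  pose fix f i := if i is i'.+1 then W (size (f i')) else W 0%N.
  have finc : increasing (size \o f).
    by apply: increasing_step => i; have [] := WP (size (f i)).
  have [i [j [ij e]]] := higman (@subwqo_mnm n) f.
  case: j ij e => [//|j] ij e.
  have [d0 Li] : exists d0, lead_word d0 (f i).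
    case: i {ij e} => [|i]; first by have [_ [d []]] := WP 0%N; exists d.
    by have [_ [d []]] := WP (size (f i)); exists d.
  have [_ [d [_ nemb]]] := WP (size (f j)).
  by apply: (nemb d0 (f i)) => //; exact: (finc _ _ ij).
exists C => d w Cw Lw; have [d0 [u [Lu uw uws]]] := CP d w Cw Lw.
have [pos [f [w' [posw wE uw']]]] := wemb_ins uw uws.
have := lead_word_valid Lw; rewrite wE wvalid_ins => /andP[fd w'd].
by exists pos, f, w'; split=> //; exact: lead_word_emb uw' w'd Lu.
Qed.

(** The division algorithm: the leading word of [F] is also that of an insertion into a tensor of
    length [e.-1]; subtracting a multiple cancels it, and finitely many words remain. *)
Lemma secmod_generated : exists C, forall d e F, (C < e)%N -> secmod d e F ->
  exists Gs : seq (nat * 'X_{1..n} * tens),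
    (forall x, x \in Gs ->
      [/\ (x.1.1 <= e.-1)%N, has_bdeg blk d x.1.2 & secmod d e.-1 x.2]) /\
    tcoef F =1 tcoef (flatten [seq tmapw (ins x.1.1 x.1.2) x.2 | x <- Gs]).
Proof.
have [C CP] := lead_word_bound; exists C => d [//|e] F Ce.
have [S [Suniq Ssort Sall]] := wvalid_finite blk d e.+1.
have wle_trans : transitive (fun u v : word => wle v u).
  by move=> y x z xy yz; exact: le_trans yz xy.
(* Invariant of the induction on [S]: downward closure among valid words, so that the lower terms of
   a subtracted tensor stay inside the list. *)
have Sdown : forall w w', w \in S -> size w' = e.+1 -> wvalid blk d w' ->
    wlt w' w -> w' \in S by move=> w w' _; auto.
move=> Fsec; have FS : forall w, tcoef F w != 0 -> w \in S.
  by move=> w /tcoef_mem[x xF <-]; have [] := Fsec.1 _ xF; exact: Sall.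
elim: S Suniq Ssort Sdown F Fsec FS {Sall} => [|w S IH] Suniq Ssort Sdown F Fsec FS.
  exists [::]; split=> // w; rewrite /= [RHS]/tcoef /tlin big_nil.
  by apply/eqP; apply: contraT => /FS.
have {}IH := IH (proj2 (andP Suniq)) (path_sorted Ssort).
have wmax v : v \in S -> wlt v w.
  move=> vS; rewrite /wlt lt_neqAle (_ : (v : seqlexi _) != w) ?andTb; last first.
    by apply: contraTneq vS => ->; case/andP: Suniq.
  by have /allP/(_ _ vS) := order_path_min wle_trans Ssort.
have Sdown' v v' : v \in S -> size v' = e.+1 -> wvalid blk d v' -> wlt v' v -> v' \in S.
  move=> vS v'e v'd v'v; have := Sdown v v'; rewrite !inE vS orbT.
  move=> /(_ isT v'e v'd v'v)/orP[/eqP E|//].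
  by move: v'v (wmax _ vS); rewrite E /wlt => /lt_trans h /h; rewrite ltxx.
have [Fw0|Fw] := eqVneq (tcoef F w) 0.
  apply: IH => // v Fv; have := FS v Fv; rewrite inE => /orP[/eqP E|//].
  by rewrite E Fw0 eqxx in Fv.
have [we wd] : size w = e.+1 /\ wvalid blk d w.
  by have [x xF <-] := tcoef_mem Fw; have [] := Fsec.1 _ xF.
have Fv0 v : v \notin w :: S -> tcoef F v = 0.
  by move=> vS; apply/eqP; apply: contraNT vS; exact: FS.
have Flead : lead F w.
  split=> // v wv; apply: Fv0; apply/negP; rewrite inE => /orP[/eqP E|/wmax vw].
    by rewrite E /wlt ltxx in wv.
  by move: wv vw; rewrite /wlt => /lt_trans h /h; rewrite ltxx.
have Lw : lead_word d w by exists F; rewrite we.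
have [|pos [f [w' [posw fd wE [G [Gsec Glead]]]]]] := CP d w _ Lw; first by rewrite we.
have w'e : size w' = e by move: we; rewrite wE size_ins => -[].
rewrite w'e in Gsec posw.
have [Hw Hlt] : lead (tmapw (ins pos f) G) w.
  rewrite wE; apply: (@lead_map _ _ _ e) => // [x xG|u v ue ve].
    by have [] := Gsec.1 _ xG.
  by apply: wlt_ins; rewrite ue ve.
have Hsec := secmod_ins posw fd Gsec.
set H := tmapw (ins pos f) G in Hw Hlt Hsec.
pose c := tcoef F w / tcoef H w.
have [||Gs [GsP GsE]] := IH Sdown' (F ++ tscale (- c) H).
- by apply: secmod_cat => //; exact: secmod_scale.
- move=> v; rewrite tcoef_cat tcoef_scale; apply: contraNT => vS.
  have [->|vw] := eqVneq v w; first by rewrite mulNr /c divfK // subrr.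
  rewrite Fv0 ?inE ?negb_or ?vw // add0r mulf_eq0; apply/orP; right.
  apply: contraNT vS => Hv; have [x xH xv] := tcoef_mem Hv.
  have [xe xd] := Hsec.1 _ xH; rewrite xv in xe xd.
  have := Sdown w v (mem_head _ _) xe xd; rewrite inE (negPf vw); apply.
  move: vw; rewrite /wlt; case: (ltgtP (v : seqlexi 'X_{1..n}) w) => // wv _.
  by rewrite (Hlt v wv) eqxx in Hv.
exists ((pos, f, tscale c G) :: Gs); split=> [x|v].
  by rewrite inE => /orP[/eqP->|/GsP//] /=; split=> //; exact: secmod_scale.
rewrite /= tcoef_cat -GsE tcoef_cat tcoef_scale.
have -> : tmapw (ins pos f) (tscale c G) = tscale c H by rewrite /H /tmapw /tscale -!map_comp.
by rewrite tcoef_scale mulNr addrCA subrr addr0.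
Qed.

End SecantModule.

(** * The secant ideal as a kernel *)

Section SecantKernel.
Variables (k : fieldType) (n m : nat) (I : 'I_m -> polyset k n).

Definition cpy (r N : nat) (E : 'I_r -> 'I_n -> 'I_N) (s : 'I_r) :
    {mpoly k[n]} -> {mpoly k[N]} := subst (fun j => 'X_(E s j)).
HB.instance Definition _ r N E s := GRing.RMorphism.on (@cpy r N E s).

(** Generators of the ideal of [r]-tuples of points of X, the product of the X_i; [E s] names the
    coordinates of the [s]-th point. *)
Definition copies (r N : nat) (E : 'I_r -> 'I_n -> 'I_N) : polyset k N :=
  fun q => exists s i f, I i f /\ q = cpy E s f.

Lemma cpy_Iext (r N : nat) (E : 'I_r -> 'I_n -> 'I_N) s p :
  Iext I p -> in_ideal_gen (copies E) (cpy E s p).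
Proof.
by apply: subst_ideal => q [i Iq]; apply: ideal_gen; exists s, i, q.
Qed.

Lemma join_ext D (A B B' : polyset k D) p :
  (forall q, B q <-> B' q) -> join A B p -> join A B' p.
Proof.
move=> BB'; apply: ideal_sub => q [h|[b [/BB' Bb ->]]]; apply: ideal_gen; first by left.
by right; exists b.
Qed.

(** By iterating [join_kernel], the secant ideal is the kernel of evaluation at a sum of [r.+1]
    points. [N], [E] and [cp] come before [b], hence serve every multidegree. *)
Lemma sec_kernel (r : nat) : exists N (E : 'I_r.+1 -> 'I_n -> 'I_N) (cp : 'I_N -> 'I_r.+1),
  (forall s j, cp (E s j) = s) /\
  forall D (b : 'I_D -> {mpoly k[n]}) p, sec_ideal I b r.+1 p <->
    in_ideal_gen (copies E) (subst (fun j => \sum_s cpy E s (b j)) p).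
Proof.
elim: r => [|r [N [E [cp [cpE secE]]]]].
  exists n, (fun _ j => j), (fun _ => ord0); split=> [s j|D b p]; first by rewrite !ord1.
  rewrite /sec_ideal /= /Jd.
  have -> : subst (fun j => \sum_(s < 1) cpy (fun _ j => j) s (b j)) p = subst b p.
    by apply: subst_eq => j; rewrite big_ord1 /cpy subst_id.
  split; apply: ideal_sub => q.
    by move=> [i Iq]; apply: ideal_gen; exists ord0, i, q; rewrite /cpy subst_id.
  by move=> [s [i [f [If ->]]]]; apply: ideal_gen; exists i; rewrite /cpy subst_id.
(* The new point takes the first [n] variables, and the earlier points are shifted past it. *)
pose E' (s : 'I_r.+2) j : 'I_(n + N) :=
  if unlift ord0 s is Some s' then rshift n (E s' j) else lshift N j.
pose cp' (i : 'I_(n + N)) : 'I_r.+2 :=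
  match split i with inl _ => ord0 | inr i' => lift ord0 (cp i') end.
have E'0 f : cpy E' ord0 f = lft N f.
  by apply: subst_eq => j; rewrite /E' unlift_none.
have E'S s f : cpy E' (lift ord0 s) f = rgt n (cpy E s f).
  rewrite /cpy /rgt subst_comp; apply: subst_eq => j.
  by rewrite /E' liftK substX.
exists (n + N)%N, E', cp'; split=> [s j|D b p].
  rewrite /E' /cp'; case: unliftP => [s'|] ->.
    by rewrite (unsplitK (inr _ _)) cpE.
  by rewrite (unsplitK (inl _ _)).
have -> : subst (fun j => \sum_s cpy E' s (b j)) p =
    subst (fun j => lft N (b j) + rgt n (\sum_s cpy E s (b j))) p.
  apply: subst_eq => j; rewrite big_ord_recl E'0 rmorph_sum /=; congr (_ + _).
  by apply: eq_bigr => s _; rewrite E'S.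
have [K1 K2] := join_kernel b (fun j => \sum_s cpy E s (b j))
  (fun q => exists i, I i q) (copies E) p.
have gens : forall q, in_ideal_gen (copies E') q <->
    in_ideal_gen (lr_gens (fun q => exists i, I i q) (copies E)) q.
  move=> q; split; apply: ideal_sub => {}q.
    move=> [s [i [f [If ->]]]]; apply: ideal_gen.
    case: (unliftP ord0 s) => [s'|] ->; [right|left].
      by exists (cpy E s' f); split=> //; exists s', i, f.
    by exists f; split=> //; exists i.
  move=> [[a [[i Ia] ->]]|[_ [[s [i [f [If ->]]]] ->]]]; apply: ideal_gen.
    by exists ord0, i, a; rewrite E'0.
  by exists (lift ord0 s), i, f; rewrite E'S.
split=> [h|/gens/K2 h].
  by apply/gens/K1; apply: join_ext h; exact: secE.
by apply: join_ext h => q; split; apply secE.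
Qed.

End SecantKernel.

(** * Multihomogeneous components *)

Section Multihomogeneous.
Variables (k : fieldType) (n m : nat) (blk : 'I_n -> 'I_m).
Implicit Types (p q : {mpoly k[n]}) (d : 'I_m -> nat).

Lemma multihomog0 d : multihomog blk d (0 : {mpoly k[n]}).
Proof. by move=> mo; rewrite msupp0. Qed.

Lemma multihomogD d p q : multihomog blk d p -> multihomog blk d q -> multihomog blk d (p + q).
Proof. by move=> hp hq mo /msuppD_le; rewrite mem_cat => /orP[/hp|/hq]. Qed.

Lemma multihomogZ d c p : multihomog blk d p -> multihomog blk d (c *: p).
Proof. by move=> hp mo /msuppZ_le/hp. Qed.

Lemma multihomog_sum d (J : Type) (s : seq J) (F : J -> {mpoly k[n]}) :
  (forall j, multihomog blk d (F j)) -> multihomog blk d (\sum_(j <- s) F j).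
Proof.
move=> h; apply: (big_ind (multihomog blk d)) => //; first exact: multihomog0.
exact: multihomogD.
Qed.

Lemma multihomog_eq d d' p : d =1 d' -> multihomog blk d p -> multihomog blk d' p.
Proof. by move=> dd h mo /h h' i; rewrite h'. Qed.

Lemma multihomogM d d' p q : multihomog blk d p -> multihomog blk d' q ->
  multihomog blk (fun i => (d i + d' i)%N) (p * q).
Proof.
move=> hp hq mo /msuppM_le/allpairsP[[m1 m2] [/= /hp h1 /hq h2 ->]] i.
by rewrite bdegD h1 h2.
Qed.

Lemma multihomogX mo : multihomog blk (bdeg blk mo) ('X_[mo] : {mpoly k[n]}).
Proof. by move=> mo'; rewrite msuppX inE => /eqP->. Qed.

Lemma multihomog1 : multihomog blk (fun=> 0%N) (1 : {mpoly k[n]}).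
Proof.
rewrite -mpolyX0; apply: (multihomog_eq _ (@multihomogX _)) => i.
by rewrite /bdeg big1 // => j _; rewrite mnm0E.
Qed.

Definition hpart d : {mpoly k[n]} -> {mpoly k[n]} :=
  mlin (fun mo => if has_bdeg blk d mo then 'X_[mo] else 0).
HB.instance Definition _ d := GRing.Linear.on (hpart d).

Lemma hpart_eq d p : multihomog blk d p -> hpart d p = p.
Proof.
move=> hp; rewrite /hpart /mlin [RHS]mpolyE; apply: eq_big_seq => mo /hp h.
by case: has_bdegP.
Qed.

Lemma hpart_neq d d' p : multihomog blk d' p -> ~ d =1 d' -> hpart d p = 0.
Proof.
move=> hp dd; rewrite /hpart /mlin big_seq big1 // => mo /hp h.
by case: has_bdegP => [h'|]; rewrite ?scaler0 //; case: dd => i; rewrite -h h'.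
Qed.

End Multihomogeneous.

Section CopiesHomogeneous.
Variables (k : fieldType) (n m : nat) (blk : 'I_n -> 'I_m) (I : 'I_m -> polyset k n).
Hypothesis hI : forall i, homog_ideal_of_block blk i (I i).
Variables (r N : nat) (E : 'I_r -> 'I_n -> 'I_N) (cp : 'I_N -> 'I_r).
Hypothesis cpE : forall s j, cp (E s j) = s.

Lemma cpyXm s mo : cpy E s 'X_[mo] = 'X_[\sum_j U_(E s j) *+ mo j] :> {mpoly k[N]}.
Proof.
by rewrite /cpy substXm -mprodXnE.
Qed.

(** Here [cp] replaces [blk] as the block map: the grading is by the degree in each of the [r]
    points. *)
Lemma multihomog_cpy s t (f : {mpoly k[n]}) : (forall mo, mo \in msupp f -> mdeg mo = t) ->
  multihomog cp (fun s' => (t * (s == s'))%N) (cpy E s f).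
Proof.
move=> hf; rewrite [f]mpolyE rmorph_sum big_seq.
apply: (big_ind (multihomog cp _)); [exact: multihomog0|exact: multihomogD|].
move=> mo /hf <-; rewrite /= /cpy substZ; apply: multihomogZ.
rewrite -/(cpy E s _) cpyXm; apply: (multihomog_eq _ (@multihomogX _ _ _ _ _)) => s'.
rewrite /bdeg (eq_bigr (fun i => \sum_j (U_(E s j) *+ mo j)%MM i)%N); last first.
  by move=> i _; rewrite mnm_sumE.
rewrite exchange_big mdegE big_distrl /=; apply: eq_bigr => j _.
under eq_bigr do rewrite mulmnE mnm1E.
rewrite -big_distrl /= mulnC; congr (_ * _)%N.
have [<-|ss'] := eqVneq s s'.
  rewrite (bigD1 (E s j)) ?cpE //= eqxx big1 ?addn0 // => i /andP[_].
  by rewrite eq_sym => /negPf->.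
rewrite big1 // => i /eqP ci; case: eqP => // Ei; move: ci; rewrite -Ei cpE => ci.
by rewrite ci eqxx in ss'.
Qed.

(** The ideals [I i] are homogeneous, so generators may be split into forms; a monomial multiple of
    a copied form is multihomogeneous, and [hpart] keeps or kills it. *)
Lemma copies_hpart g p : in_ideal_gen (copies I E) p ->
  in_ideal_gen (copies I E) (hpart cp g p).
Proof.
move: p; apply: ideal_min => [|p q hp hq|a _ [s [i [f [If ->]]]]].
- by rewrite linear0; exact: ideal0.
- by rewrite linearD; exact: idealD.
rewrite [f](pihomog_partitionE (leqnn (msize f))) rmorph_sum mulr_sumr linear_sum /=.
apply: ideal_sum => t _ _.
have If' : I i (pihomog mdeg t f) by have [_ _ _ _] := hI i; apply.
rewrite [a]mpolyE mulr_suml linear_sum /=; apply: ideal_sum => mo _ _.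
have hh : multihomog cp (fun s' => (bdeg cp mo s' + t * (s == s'))%N)
    (a@_mo *: 'X_[mo] * cpy E s (pihomog mdeg t f)).
  apply: multihomogM; first by apply: multihomogZ; exact: multihomogX.
  by apply: multihomog_cpy; apply/dhomogP; exact: pihomogP.
have [gE|gE] := classic (g =1 (fun s' => (bdeg cp mo s' + t * (s == s'))%N)).
  rewrite hpart_eq; last by apply: (multihomog_eq _ hh) => s'; rewrite gE.
  by apply/idealM/ideal_gen; exists s, i, (pihomog mdeg t f).
by rewrite (hpart_neq hh gE); exact: ideal0.
Qed.

End CopiesHomogeneous.

(** * Polarization *)

Section Euler.
Variables (k : fieldType) (D : nat).
Implicit Type p : {mpoly k[D]}.

Lemma dhomog_mdeg e p mo : p \is e.-homog -> mo \in msupp p -> mdeg mo = e.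
Proof. by move=> /dhomogP; apply. Qed.

Lemma dhomog_mderiv e p j : p \is e.+1.-homog -> p^`M(j) \is e.-homog.
Proof.
move=> hp; apply/dhomogP => mo; rewrite mcoeff_msupp mcoeff_deriv => h.
have /(dhomog_mdeg hp) : (mo + U_(j))%MM \in msupp p.
  by rewrite mcoeff_msupp; apply: contraNneq h => ->; rewrite mul0rn.
by rewrite mdegD mdeg1 addn1 => -[].
Qed.

Lemma euler e p : p \is e.-homog -> \sum_j 'X_j * p^`M(j) = e%:R *: p.
Proof.
move=> hp; rewrite [in LHS](mpolyE p) [in RHS](mpolyE p).
under eq_bigr do rewrite linear_sum mulr_sumr.
rewrite exchange_big scaler_sumr; apply: eq_big_seq => mo /(dhomog_mdeg hp) moe /=.
rewrite -moe mdegE natr_sum scaler_suml; apply: eq_bigr => j _.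
rewrite mderivZ mderivX -!scalerAr scalerA mulrC -scalerA -mpolyXD.
have [E|mj] := eqVneq (mo j) 0%N; first by rewrite E !scale0r.
by rewrite addmC submK // lep1mP.
Qed.

Lemma dhomog0C p : p \is 0.-homog -> p = (p@_0)%:MP.
Proof.
move=> hp; apply/mpolyP => mo; rewrite mcoeffC.
have [->|mo0] := eqVneq mo 0%MM; first by rewrite mulr1.
rewrite mulr0; apply/eqP; rewrite mcoeff_eq0.
by apply: contra mo0 => /(dhomog_mdeg hp)/eqP; rewrite mdeg_eq0.
Qed.

End Euler.

Section Polarization.
Variables (k : fieldType) (D r N : nat) (c : 'I_r -> 'I_D -> {mpoly k[N]}).
Implicit Types (p : {mpoly k[D]}) (phi psi : seq 'I_r).

(* For p homogeneous of degree [size phi], this is the polarized form of p at the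
   points [c (phi_1)], [c (phi_2)], etc. *)
Fixpoint polar phi p : {mpoly k[N]} :=
  if phi is s :: phi' then \sum_j c s j * polar phi' p^`M(j) else (p@_0)%:MP.

Fixpoint all_words e : seq (seq 'I_r) :=
  if e is e'.+1 then [seq s :: phi | s <- enum 'I_r, phi <- all_words e'] else [:: [::]].

Lemma mem_all_words e phi : (phi \in all_words e) = (size phi == e).
Proof.
elim: e phi => [|e IH] [|s phi] //=.
  by apply/negP => /allpairsP[[x y] [_ _]].
rewrite eqSS -IH; apply/allpairsP/idP => [[[x y] [_ /= hy [_ ->]]]//|h].
by exists (s, phi); rewrite mem_enum.
Qed.

Lemma polar_swap s t phi p : polar (s :: t :: phi) p = polar (t :: s :: phi) p.
Proof.
rewrite /=; under eq_bigr do rewrite mulr_sumr; rewrite exchange_big /=.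
apply: eq_bigr => j _; rewrite mulr_sumr; apply: eq_bigr => i _.
by rewrite mulrCA mderiv_comm.
Qed.

Lemma polar_rem s phi p : s \in phi -> polar phi p = polar (s :: rem s phi) p.
Proof.
elim: phi p => [//|t phi IH] p; rewrite inE /=; have [->//|ts] := eqVneq t s.
rewrite /= => sphi.
transitivity (polar (t :: s :: rem s phi) p); last exact: polar_swap.
by rewrite [LHS]/=; apply: eq_bigr => j _; rewrite IH.
Qed.

(** Partial derivatives commute, so adjacent entries may be exchanged. *)
Lemma polar_perm phi psi p : perm_eq phi psi -> polar phi p = polar psi p.
Proof.
elim: phi psi p => [|s phi IH] psi p; first by rewrite perm_sym => /perm_nilP->.
move=> h; have sp : s \in psi by rewrite -(perm_mem h) mem_head.
rewrite (polar_rem _ sp) /=; apply: eq_bigr => j _; rewrite (IH (rem s psi)) //.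
by rewrite -(perm_cons s) (perm_trans h) // perm_to_rem.
Qed.

(** By multilinearity the left side is the polar form with every entry equal to the sum of the
    points; Euler's identity evaluates it. *)
Lemma polar_sum e p : p \is e.-homog ->
  \sum_(phi <- all_words e) polar phi p = (e`!)%:R *: subst (fun j => \sum_s c s j) p.
Proof.
elim: e p => [|e IH] p hp.
  by rewrite /= big_seq1 /= {2}(dhomog0C hp) substC scale1r.
rewrite /= big_allpairs_dep /= (eq_bigr (fun s => \sum_j c s j *
    \sum_(phi <- all_words e) polar phi p^`M(j))); last first.
  by move=> s _; rewrite exchange_big; apply: eq_bigr => j _; rewrite mulr_sumr.
rewrite big_enum exchange_big /=.
have -> : (e.+1)`!%:R *: subst (fun j => \sum_s c s j) p =
    e`!%:R *: subst (fun j => \sum_s c s j) (\sum_j 'X_j * p^`M(j)).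
  by rewrite (euler hp) substZ scalerA -natrM mulnC.
rewrite rmorph_sum scaler_sumr; apply: eq_bigr => j _.
by rewrite -mulr_suml IH ?dhomog_mderiv // rmorphM /= substX scalerAr.
Qed.

Lemma multihomog_polar (cp : 'I_N -> 'I_r) (t : nat) :
  (forall s j, multihomog cp (fun s' => (t * (s == s'))%N) (c s j)) ->
  forall phi p, multihomog cp (fun s => (t * count_mem s phi)%N) (polar phi p).
Proof.
move=> hc; elim=> [|s phi IH] p /=.
  rewrite -[_%:MP]mulr1 mul_mpolyC; apply: multihomogZ.
  by apply: (multihomog_eq _ (@multihomog1 _ _ _ _)) => s; rewrite muln0.
apply: multihomog_sum => j; apply: (multihomog_eq _ (multihomogM (hc s j) (IH _))) => s'.
by rewrite mulnDr.
Qed.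

End Polarization.

(** * Forms as symmetric tensors, and multiplying tensors out *)

Section PolarTensor.
Variables (k : fieldType) (n D : nat) (b : 'I_D -> {mpoly k[n]}).
Notation tens := (seq (k * seq 'X_{1..n})).

(** For [p] homogeneous of degree [e], this is [e!] times its symmetric tensor, with each [b j]
    expanded into monomials. *)
Fixpoint ptens e (p : {mpoly k[D]}) : tens :=
  if e is e'.+1 then flatten [seq flatten [seq
    [seq ((b j)@_mo * x.1, mo :: x.2) | x <- ptens e' p^`M(j)] | mo <- msupp (b j)]
    | j <- enum 'I_D] else [:: (p@_0, [::])].

Lemma tlin_ptens (V : lmodType k) (g : seq 'X_{1..n} -> V) e p :
  tlin g (ptens e.+1 p) =
  \sum_j \sum_(mo <- msupp (b j)) (b j)@_mo *: tlin (fun w => g (mo :: w)) (ptens e p^`M(j)).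
Proof.
rewrite /tlin /= big_flatten big_map big_enum; apply: eq_bigr => j _.
rewrite big_flatten big_map; apply: eq_bigr => mo _.
by rewrite big_map scaler_sumr; apply: eq_bigr => x _; rewrite scalerA.
Qed.

Lemma ptens_valid m (blk : 'I_n -> 'I_m) d e p x :
  (forall j, multihomog blk d (b j)) ->
  x \in ptens e p -> size x.2 = e /\ wvalid blk d x.2.
Proof.
move=> bd; elim: e p x => [|e IH] p x /=; first by rewrite inE => /eqP->.
move=> /flatten_mapP[j _ /flatten_mapP[mo moj /mapP[y /IH[ye yd] ->]]] /=.
by rewrite ye yd andbT; split=> //; apply/has_bdegP; exact: bd moj.
Qed.

Lemma ev_ptens r N (E : 'I_r -> 'I_n -> 'I_N) phi p :
  tlin (ev (fun s mo => cpy E s ('X_[mo] : {mpoly k[n]})) phi) (ptens (size phi) p) =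
  polar (fun s j => cpy E s (b j)) phi p.
Proof.
elim: phi p => [|s phi IH] p.
  by rewrite /tlin /= big_seq1 /ev /= big_nil -mul_mpolyC mulr1.
rewrite tlin_ptens /=; apply: eq_bigr => j _.
rewrite {3}(mpolyE (b j)) rmorph_sum mulr_suml; apply: eq_bigr => mo _ /=.
rewrite {2}/cpy substZ -scalerAl; congr (_ *: _); rewrite -IH /tlin mulr_sumr.
by apply: eq_bigr => x _; rewrite /ev /= big_cons /= -scalerAr.
Qed.

Variable lf : 'X_{1..n} -> {mpoly k[D]}.

Definition wprod (w : seq 'X_{1..n}) : {mpoly k[D]} := \prod_(a <- w) lf a.

Lemma wprod_ptens e p : (forall j, \sum_(mo <- msupp (b j)) (b j)@_mo *: lf mo = 'X_j) ->
  p \is e.-homog -> tlin wprod (ptens e p) = (e`!)%:R *: p.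
Proof.
move=> lfb; elim: e p => [|e IH] p hp.
  by rewrite /tlin /= big_seq1 /wprod big_nil {2}(dhomog0C hp) scale1r -mul_mpolyC mulr1.
rewrite tlin_ptens factS mulnC natrM -scalerA -(euler hp) scaler_sumr.
apply: eq_bigr => j _; rewrite scalerAr -IH ?dhomog_mderiv // -lfb mulr_suml.
apply: eq_bigr => mo _; rewrite -scalerAl; congr (_ *: _); rewrite /tlin mulr_sumr.
by apply: eq_bigr => x _; rewrite /wprod big_cons -scalerAr.
Qed.

(** Commutativity forgets the position: an insertion becomes multiplication by a linear form. *)
Lemma wprod_ins pos f w : wprod (ins pos f w) = lf f * wprod w.
Proof.
rewrite /wprod /ins big_cat big_cons /= mulrCA -big_cat /=.
by rewrite cat_take_drop.
Qed.

End PolarTensor.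

Lemma ideal_prod_congr (k : fieldType) (n : nat) (S : polyset k n) (T : eqType)
    (w : seq T) (A B : T -> {mpoly k[n]}) :
  (forall a, a \in w -> in_ideal_gen S (A a - B a)) ->
  in_ideal_gen S (\prod_(a <- w) A a - \prod_(a <- w) B a).
Proof.
elim: w => [|a w IH] h; first by rewrite !big_nil subrr; exact: ideal0.
rewrite !big_cons; set PA := \prod_(_ <- w) A _; set PB := \prod_(_ <- w) B _.
have -> : A a * PA - B a * PB = A a * (PA - PB) + PB * (A a - B a).
  by rewrite !mulrBr addrA [PB * A a]mulrC subrK [PB * _]mulrC.
apply: idealD; apply: idealM; last exact: h (mem_head _ _).
by apply: IH => x xw; apply: h; rewrite inE xw orbT.
Qed.

Lemma prod_sum_ev (k : fieldType) (n r N : nat) (X : 'I_r -> 'X_{1..n} -> {mpoly k[N]}) w :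
  \prod_(a <- w) \sum_s X s a = \sum_(phi <- all_words r (size w)) ev X phi w.
Proof.
elim: w => [|a w IH]; first by rewrite big_nil big_seq1 /ev /= big_nil.
rewrite big_cons IH /= big_allpairs_dep /= big_enum mulr_suml; apply: eq_bigr => s _.
by rewrite mulr_sumr; apply: eq_bigr => phi _; rewrite /ev /= big_cons.
Qed.

(** * Secant forms versus tensors vanishing on tuples with few distinct points *)

Section Secant.
Variables (k : fieldType) (n m : nat) (blk : 'I_n -> 'I_m) (I : 'I_m -> polyset k n).
Hypothesis hchar : [pchar k] =i pred0.
Hypothesis hI : forall i, homog_ideal_of_block blk i (I i).
Variables (r N : nat) (E : 'I_r -> 'I_n -> 'I_N) (cp : 'I_N -> 'I_r).
Hypothesis cpE : forall s j, cp (E s j) = s.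
Variables (d : 'I_m -> nat) (D : nat) (b : 'I_D -> {mpoly k[n]}).
Hypothesis bd : forall j, multihomog blk d (b j).
Hypothesis d_gt0 : (0 < \sum_i d i)%N.

Notation L := (in_ideal_gen (copies I E)).
Notation secmap := (subst (fun j => \sum_s cpy E s (b j))).
Notation Xc := (fun s mo => cpy E s ('X_[mo] : {mpoly k[n]})).
Implicit Types (p : {mpoly k[D]}).

Lemma natr_neq0 t : (0 < t)%N -> t%:R != 0 :> k.
Proof. by move/pcharf0P: hchar => ->; rewrite lt0n. Qed.

(** The grading by points isolates, in the expansion of [secmap p] into polar forms, those indexed
    by rearrangements of [phi]; by symmetry they all coincide. *)
Lemma polar_secant p phi : L (secmap p) ->
  L (polar (fun s j => cpy E s (b j)) phi (pihomog mdeg (size phi) p)).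
Proof.
move=> Lp; set c := fun s j => cpy E s (b j); set e := size phi.
(* The total degree of each [b j]. It is positive, so degrees in the points determine how often each
   point occurs. *)
pose t0 := (\sum_i d i)%N.
have polh psi q : multihomog cp (fun s => (t0 * count_mem s psi)%N) (polar c psi q).
  apply: multihomog_polar => s j; apply: multihomog_cpy => // mo /bd h.
  by rewrite -(sum_bdeg blk); apply: eq_bigr.
pose g s := (t0 * count_mem s phi)%N.
have gpol psi q : hpart cp g (polar c psi q) =
    if perm_eq phi psi then polar c phi q else 0.
  case: ifPn => pp.
    rewrite (polar_perm c q pp) hpart_eq //; apply: (multihomog_eq _ (polh psi q)) => s.
    by rewrite /g; congr (_ * _)%N; apply/esym; move/permP: pp => ->.
  apply: (hpart_neq (polh psi q)) => gE; move/negP: pp; apply; apply/allP => s _ /=.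
  by have /eqP := gE s; rewrite /g eqn_pmul2l // /t0.
(* Exceeding [e] ensures that the component of degree [e] is listed, even when it is zero. *)
pose M := maxn (msize p) e.+1.
have eM : (e < M)%N by rewrite leq_max leqnn orbT.
have secE t : hpart cp g (secmap (pihomog mdeg t p)) = (t`!%:R)^-1 *:
    \sum_(psi <- all_words r t) if perm_eq phi psi then polar c phi (pihomog mdeg t p) else 0.
  have := polar_sum c (pihomogP mdeg t p) => /(congr1 (fun z => (t`!%:R)^-1 *: z)).
  rewrite scalerA mulVf ?natr_neq0 ?fact_gt0 // scale1r => <-.
  by rewrite linearZ linear_sum /=; congr (_ *: _); apply: eq_bigr => psi _; rewrite gpol.
have pM : (msize p <= M)%N by rewrite leq_max leqnn.
have := copies_hpart hI cpE g Lp.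
rewrite {1}(pihomog_partitionE pM) rmorph_sum linear_sum /= (bigD1 (Ordinal eM)) //=.
rewrite [X in _ + X]big1 ?addr0 => [|t te]; last first.
  rewrite secE big_seq big1 ?scaler0 // => psi; rewrite mem_all_words => /eqP psit.
  case: ifP => // /perm_size; rewrite psit -/e => et; move/eqP: te; case.
  by apply: val_inj; rewrite /= et.
rewrite secE -big_mkcond /= big_const_seq iter_addr_0 -scaler_nat scalerA.
(* [q] is the number of rearrangements of [phi] over [e!], nonzero in characteristic 0. *)
set q := _ * _ => Lq; have q0 : q != 0.
  rewrite mulf_neq0 ?invr_neq0 ?natr_neq0 ?fact_gt0 // -has_count.
  by apply/hasP; exists phi; rewrite ?mem_all_words.
by have := idealZ q^-1 Lq; rewrite scalerA mulVf // scale1r.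
Qed.

Lemma secant_pihomog p e : L (secmap p) -> L (secmap (pihomog mdeg e p)).
Proof.
move=> Lp; have := polar_sum (fun s j => cpy E s (b j)) (pihomogP mdeg e p).
move=> /(congr1 (fun z => (e`!%:R)^-1 *: z)).
rewrite scalerA mulVf ?natr_neq0 ?fact_gt0 // scale1r => <-; apply: idealZ.
apply: ideal_sum => phi; rewrite mem_all_words => /eqP <- _.
exact: polar_secant.
Qed.

Lemma ptens_secmod p e : p \is e.-homog -> L (secmap p) ->
  secmod blk L Xc d e (ptens b e p).
Proof.
move=> hp Lp; split=> [x|phi phie]; first exact: ptens_valid.
rewrite -phie ev_ptens; have := polar_secant phi Lp.
by rewrite phie (pihomog_dE hp).
Qed.

Variable co : 'X_{1..n} -> 'I_D -> k.
Hypothesis coE : forall a, has_bdeg blk d a -> Iext I ('X_[a] - \sum_j co a j *: b j).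

Definition lform (a : 'X_{1..n}) : {mpoly k[D]} := \sum_j co a j *: 'X_j.

(** Modulo [L], [secmap] sends [lform a] to the sum of the values of the monomial [a] at the points;
    expanding the product over a word gives its values on all tuples [phi]. *)
Lemma wprod_secant e G : secmod blk L Xc d e G -> L (secmap (tlin (wprod lform) G)).
Proof.
move=> [G1 G2].
have -> : secmap (tlin (wprod lform) G) = tlin (fun w => secmap (wprod lform w)) G.
  by rewrite /tlin rmorph_sum; apply: eq_bigr => x _; rewrite /= substZ.
apply: (@ideal_congr _ _ _ _
  (tlin (fun w => \sum_(phi <- all_words r (size w)) ev Xc phi w) G)).
  rewrite /tlin -sumrB; apply: ideal_sum => x xG _; rewrite -scalerBr; apply: idealZ.
  rewrite -prod_sum_ev /wprod rmorph_prod; apply: ideal_prod_congr => a ax /=.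
  have -> : secmap (lform a) = \sum_s cpy E s (\sum_j co a j *: b j).
    rewrite /lform rmorph_sum /=; under eq_bigr do rewrite substZ substX scaler_sumr.
    rewrite exchange_big; apply: eq_bigr => s _; rewrite /= rmorph_sum.
    by apply: eq_bigr => j _; rewrite /= /cpy substZ.
  rewrite -sumrB; apply: ideal_sum => s _ _; rewrite -rmorphB; apply: cpy_Iext.
  rewrite -opprB -scaleN1r; apply/idealZ/coE.
  by have [_ /allP] := G1 _ xG; apply.
have -> : tlin (fun w => \sum_(phi <- all_words r (size w)) ev Xc phi w) G =
    \sum_(phi <- all_words r e) tlin (ev Xc phi) G.
  rewrite /tlin exchange_big; apply: eq_big_seq => x xG /=.
  by have [-> _] := G1 _ xG; rewrite scaler_sumr.
by apply: ideal_sum => phi; rewrite mem_all_words => /eqP phie _; exact: G2.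
Qed.

Lemma wprod_homog w : wprod lform w \is (size w).-homog.
Proof.
elim: w => [|a w IH]; first by rewrite /wprod big_nil dhomog1.
rewrite /wprod big_cons -[size _]/(1 + size w)%N; apply: dhomogM => //.
by apply: rpred_sum => j _; apply: dhomogZ; rewrite dhomogX /= mdeg1.
Qed.

Lemma tlin_wprod_homog e G : secmod blk L Xc d e G -> tlin (wprod lform) G \is e.-homog.
Proof.
move=> [G1 _]; rewrite /tlin big_seq; apply: rpred_sum => x /G1[<- _].
by apply: dhomogZ; exact: wprod_homog.
Qed.

(** Rewriting the monomials of [b j] in the basis gives [b j] back modulo [Iext], so freeness forces
    the coordinates of [b j] to be those of the [j]-th basis vector. *)
Lemma lform_basis : (forall c : 'I_D -> k, Iext I (\sum_j c j *: b j) -> forall j, c j = 0) ->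
  forall j, \sum_(mo <- msupp (b j)) (b j)@_mo *: lform mo = 'X_j.
Proof.
move=> bfree j.
pose c i := \sum_(mo <- msupp (b j)) (b j)@_mo * co mo i.
have -> : \sum_(mo <- msupp (b j)) (b j)@_mo *: lform mo = \sum_i c i *: 'X_i.
  under eq_bigr do rewrite scaler_sumr; rewrite exchange_big; apply: eq_bigr => i _.
  by rewrite /c scaler_suml; apply: eq_bigr => mo _; rewrite scalerA.
have cE : forall i, (i == j)%:R - c i = 0.
  apply: bfree.
  have -> : \sum_i ((i == j)%:R - c i) *: b i =
      \sum_(mo <- msupp (b j)) (b j)@_mo *: ('X_[mo] - \sum_i co mo i *: b i).
    under eq_bigr do rewrite scalerBl; rewrite sumrB (bigD1 j) //= eqxx scale1r.
    rewrite [X in _ + X - _]big1 ?addr0 => [|i /negPf->]; last by rewrite scale0r.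
    under [RHS]eq_bigr do rewrite scalerBr; rewrite sumrB -mpolyE; congr (_ - _).
    under [RHS]eq_bigr do rewrite scaler_sumr; rewrite exchange_big; apply: eq_bigr => i _.
    by rewrite /c scaler_suml; apply: eq_bigr => mo _; rewrite scalerA.
  apply: ideal_sum => mo moj _; apply/idealZ/coE.
  by apply/has_bdegP; exact: bd moj.
rewrite (bigD1 j) //= big1 ?addr0 => [|i /negPf ij].
  by have /eqP := cE j; rewrite eqxx subr_eq0 => /eqP <-; rewrite scale1r.
by have /eqP := cE i; rewrite ij sub0r oppr_eq0 => /eqP ->; rewrite scale0r.
Qed.

End Secant.

Theorem theorem6p3 (k : fieldType) (hchar : [pchar k] =i pred0)
    (m : nat) (hm : (0 < m)%N) (n : nat) (blk : 'I_n -> 'I_m)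
    (I : 'I_m -> polyset k n)
    (hI : forall i, homog_ideal_of_block blk i (I i))
    (r : nat) (hr : (0 < r)%N) :
  exists C : nat,
    forall (d : 'I_m -> nat), (forall i, (0 < d i)%N) ->
    forall (D : nat) (b : 'I_D -> {mpoly k[n]}),
      is_basis_Rd blk I d b ->
      generated_in_degree_le (sec_ideal I b r) C.
Proof.
case: r hr => // r _; have [N [E [cp [cpE secE]]]] := sec_kernel I r.
pose X s (mo : 'X_{1..n}) : {mpoly k[N]} := cpy E s 'X_[mo].
have XD s a a' : X s (a + a')%MM = X s a * X s a' by rewrite /X mpolyXD rmorphM.
(* [C] depends only on the ideal of [copies I E] and on [X], both fixed before [d] is introduced. *)
have [C CP] := secmod_generated blk (@idealD _ _ (copies I E)) (@idealM _ _ _) XD.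
exists C => d d_gt0 D b [bd bfree bspan] p.
have sum_d : (0 < \sum_i d i)%N.
  by rewrite (bigD1 (Ordinal hm)) //= ltn_addr.
have [co coE] : exists co : 'X_{1..n} -> 'I_D -> k, forall a, has_bdeg blk d a ->
    Iext I ('X_[a] - \sum_j co a j *: b j).
  apply: (functional_choice (fun (a : 'X_{1..n}) (c : 'I_D -> k) => has_bdeg blk d a ->
    Iext I ('X_[a] - \sum_j c j *: b j))) => a.
  have [/has_bdegP ad|na] := boolP (has_bdeg blk d a); last by exists (fun=> 0).
  have [|c cP] := bspan 'X_[a]; last by exists c.
  exact: (multihomog_eq ad (@multihomogX _ _ _ _ _)).
pose v j := \sum_s cpy E s (b j).
split=> [/secE Lp|]; last first.
  move=> h; apply/secE; move: p h; apply: ideal_min => [|q q' hq hq'|a q [/secE hq _]].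
  - by rewrite rmorph0; exact: ideal0.
  - by rewrite rmorphD; exact: idealD.
  - by rewrite rmorphM; exact: idealM.
(* Induction on the degree: above [C], the tensor of [q] is a sum of insertions, which multiply out
   to linear forms times secant forms of one degree less. *)
have gen e q : q \is e.-homog -> in_ideal_gen (copies I E) (subst v q) ->
    in_ideal_gen (fun q => sec_ideal I b r.+1 q /\ (msize q <= C.+1)%N) q.
  elim: e q => [|e IH] q hq Lq.
    apply: ideal_gen; split; first exact/secE.
    by rewrite (dhomog0C hq) msizeC; apply: leq_trans (leq_b1 _) _.
  have [eC|Ce] := leqP e.+1 C.
    apply: ideal_gen; split; first exact/secE.
    rewrite msizeE; apply/bigmax_leqP_seq => mo moq _.
    by rewrite (dhomog_mdeg hq moq).
  have qsec := ptens_secmod hchar hI cpE bd sum_d hq Lq.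
  have [Gs [GsP GsE]] := CP d e.+1 _ Ce qsec.
  have := wprod_ptens (lform_basis bd coE bfree) hq.
  rewrite (tcoef_lin _ GsE) => /(congr1 (fun z => ((e.+1)`!%:R)^-1 *: z)).
  rewrite scalerA mulVf ?(natr_neq0 hchar) ?fact_gt0 // scale1r => <-; apply: idealZ.
  rewrite /tlin big_flatten big_map; apply: ideal_sum => x xGs _.
  have [_ _ xsec] := GsP x xGs.
  rewrite -/(tlin _ _) tlin_map.
  have -> : tlin (wprod (lform co) \o ins x.1.1 x.1.2) x.2 =
      lform co x.1.2 * tlin (wprod (lform co)) x.2.
    rewrite /tlin mulr_sumr; apply: eq_bigr => y _.
    by rewrite /= wprod_ins scalerAr.
  apply: idealM; apply: IH; first exact: tlin_wprod_homog xsec.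
  exact: wprod_secant coE _ _ xsec.
(* The secant ideal contains the homogeneous components of its elements, so forms suffice. *)
rewrite (pihomog_partitionE (leqnn (msize p))); apply: ideal_sum => t _ _.
apply: (gen t); first exact: pihomogP.
exact: (secant_pihomog hchar hI cpE bd sum_d).
Qed.
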